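(* Let $\mathcal F_0=\{f_i\}_{i\in\mathbb I_{n_0}}$ be a finite sequence of vectors in $\mathbb C^d$, let $\mathbf a=(a_i)_{i\in\mathbb I_k}$ with $a_1\ge a_2\ge\cdots\ge a_k>0$, and let $\varphi:[0,\infty)\to[0,\infty)$ be a strictly convex function. Let $\mathcal G_0\in\mathbb T_{\mathbb C^d}(\mathbf a)$ be a local minimizer (with respect to the metric $d$) of the function $\Psi_\varphi:\mathbb T_{\mathbb C^d}(\mathbf a)\to[0,\infty)$ given by $\Psi_\varphi(\mathcal G)=\operatorname{tr}\big(\varphi(S_{\mathcal F_0}+S_{\mathcal G})\big)$. Then $\mathcal G_0$ is also a global minimizer of $\Psi_\varphi$ in $\mathbb T_{\mathbb C^d}(\mathbf a)$.
   Context: $\mathbb I_m=\{1,\dots,m\}$. For $x,y\in\mathbb C^d$, $x\otimes y$ is the $d\times d$ matrix with $(x\otimes y)z=\langle z,y\rangle x$. The frame operator of a finite sequence $\mathcal F=\{f_i\}_{i\in\mathbb I_m}$ in $\mathbb C^d$ is $S_{\mathcal F}=\sum_{i\in\mathbb I_m} f_i\otimes f_i$, a positive semidefinite matrix. $\mathbb T_{\mathbb C^d}(\mathbf a)=\{\mathcal G=\{g_i\}_{i\in\mathbb I_k}\in(\mathbb C^d)^k:\ \|g_i\|^2=a_i,\ i\in\mathbb I_k\}$, endowed with the metric $d(\mathcal G,\tilde{\mathcal G})=\max\{\|g_i-\tilde g_i\|: i\in\mathbb I_k\}$. For a positive semidefinite $A$, $\varphi(A)$ is defined by functional calculus, so $\operatorname{tr}\varphi(A)=\sum_{i\in\mathbb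 I_d}\varphi(\lambda_i(A))$ with $\lambda_i(A)$ the eigenvalues of $A$ counted with multiplicity. Thus $\Psi_\varphi(\mathcal G)$ is the convex potential $\mathrm P_\varphi$ of the completed sequence $(\mathcal F_0,\mathcal G)$. *)

(* Defs.v *)
From mathcomp Require Import all_boot all_order all_algebra.
From mathcomp Require Import sesquilinear spectral.
From mathcomp Require Import reals.
From mathcomp Require Import complex.

Set Implicit Arguments.
Unset Strict Implicit.
Unset Printing Implicit Defensive.

Import Order.TTheory GRing.Theory Num.Theory.

Local Open Scope ring_scope.
Local Open Scope complex_scope.
Local Open Scope sesquilinear_scope.

Section Frames.
Variables (R : realType) (d : nat).
Local Notation C := R[i].
Implicit Types (x y z : 'cV[C]_d) (A : 'M[C]_d).

(* [dotmx] is defined on row vectors; it is linear in its first argument. *)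
Definition inner x y : C := dotmx x^T y^T.

Definition enorm x : R := Num.sqrt (complex.Re (inner x x)).

Definition tensor x y : 'M[C]_d := x *m y^t*.

Definition frame_op (n : nat) (F : 'I_n -> 'cV[C]_d) : 'M[C]_d :=
  \sum_(i < n) tensor (F i) (F i).

(* Functional calculus for a Hermitian matrix (whose eigenvalues are real);
   [fun_mxE] shows that the choice of the diagonalization is immaterial, and
   [PsiE] that only values of phi on nonnegative reals are used in [Psi]. *)
Definition fun_mx (phi : R -> R) A : 'M[C]_d :=
  invmx (spectralmx A)
    *m diag_mx (map_mx (fun l : C => (phi (complex.Re l))%:C) (spectral_diag A))
    *m spectralmx A.

(* The trace is real by [tr_fun_mx]; [complex.Re] transports it to R. *)
Definition Psi (phi : R -> R) (n0 k : nat) (F0 : 'I_n0 -> 'cV[C]_d)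
    (G : 'I_k -> 'cV[C]_d) : R :=
  complex.Re (\tr (fun_mx phi (frame_op F0 + frame_op G))).

Definition in_torus (k : nat) (a : 'I_k -> R) (G : 'I_k -> 'cV[C]_d) : Prop :=
  forall i, enorm (G i) ^+ 2 = a i.

Definition seq_dist (k : nat) (G G' : 'I_k -> 'cV[C]_d) : R :=
  \big[Num.max/0]_(i < k) enorm (G i - G' i).

End Frames.

Definition strictly_convex_nonneg (R : realType) (phi : R -> R) : Prop :=
  forall x y t : R, 0 <= x -> 0 <= y -> x != y -> 0 < t < 1 ->
    phi (t * x + (1 - t) * y) < t * phi x + (1 - t) * phi y.

Definition local_minimizer (R : realType) (T : Type) (dist : T -> T -> R)
    (D : T -> Prop) (f : T -> R) (x : T) : Prop :=
  D x /\ exists2 e : R, 0 < e & forall y, D y -> dist x y < e -> f x <= f y.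

Definition global_minimizer (R : realType) (T : Type)
    (D : T -> Prop) (f : T -> R) (x : T) : Prop :=
  D x /\ forall y, D y -> f x <= f y.

Section Facts.
Variables (R : realType) (d : nat).
Local Notation C := R[i].

Lemma innerE (x y : 'cV[C]_d) : inner x y = \sum_i x i 0 * (y i 0)^*%R.
Proof.
by rewrite /inner dotmxE mxE; apply: eq_bigr => i _; rewrite !mxE.
Qed.

Lemma tensorE (x y z : 'cV[C]_d) : tensor x y *m z = inner z y *: x.
Proof.
rewrite /tensor -mulmxA [y^t* *m z]mx11_scalar mul_mx_scalar; congr (_ *: _).
by rewrite innerE mxE; apply: eq_bigr => i _; rewrite !mxE mulrC.
Qed.

Lemma fun_mxE (phi : R -> R) (A P : 'M[C]_d) (l : 'rV[C]_d) :
  P \is unitarymx -> A \is normalmx -> A = invmx P *m diag_mx l *m P ->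
  fun_mx phi A =
    invmx P *m diag_mx (map_mx (fun c : C => (phi (complex.Re c))%:C) l) *m P.
Proof.
move=> /unitarymx_unit uP /orthomx_spectralP eA eA'.
have uQ := spectral_unit A; rewrite /fun_mx.
set Q := spectralmx A in eA uQ *; set m := spectral_diag A in eA *.
have [W QW] : exists W, Q = W *m P by exists (Q *m invmx P); rewrite mulmxKV.
have eW : W *m diag_mx l = diag_mx m *m W.
  have -> : diag_mx l = P *m A *m invmx P.
    by rewrite eA' !mulmxA mulmxK // mulmxV // mul1mx.
  by rewrite !mulmxA -QW {1}eA !mulmxA mulmxV // mul1mx {1}QW mulmxA mulmxK.
have h i j : W i j * l 0 j = m 0 i * W i j.
  by move/matrixP: eW => /(_ i j); rewrite mul_mx_diag mul_diag_mx !mxE.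
set g := fun _ => _.
have eg : W *m diag_mx (map_mx g l) = diag_mx (map_mx g m) *m W.
  apply/matrixP => i j; rewrite mul_mx_diag mul_diag_mx !mxE.
  have [->|W0] := eqVneq (W i j) 0; first by rewrite mul0r mulr0.
  by rewrite mulrC; congr (g _ * _); apply: (mulIf W0); rewrite -h mulrC.
by rewrite -mulmxA {2}QW [diag_mx _ *m _]mulmxA -eg !mulmxA -{1}(mulmxK uP W) -QW
           !mulmxA mulVmx // mul1mx.
Qed.

Lemma tr_fun_mx (phi : R -> R) (A : 'M[C]_d) :
  \tr (fun_mx phi A) = (\sum_i phi (complex.Re (spectral_diag A 0 i)))%:C.
Proof.
rewrite /fun_mx mxtrace_mulC mulmxA mulmxV ?spectral_unit // mul1mx.
rewrite mxtrace_diag rmorph_sum /=; apply: eq_bigr => i _; by rewrite mxE.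
Qed.

Lemma char_poly_spectral (A : 'M[C]_d) : A \is normalmx ->
  char_poly A = \prod_i ('X - (spectral_diag A 0 i)%:P).
Proof.
move=> /orthomx_spectralP eA; have uQ := spectral_unit A; move: eA.
move: (spectralmx A) (spectral_diag A) uQ => Q m uQ eA.
have -> : char_poly A = char_poly (diag_mx m).
  have PQ : map_mx polyC (invmx Q) *m map_mx polyC Q = 1%:M.
    by rewrite -map_mxM mulVmx // map_mx1.
  have -> : char_poly A = \det (map_mx polyC (invmx Q)
      *m char_poly_mx (diag_mx m) *m map_mx polyC Q).
    rewrite /char_poly /char_poly_mx mulmxBr mulmxBl mul_mx_scalar -scalemxAl PQ.
    by rewrite -!map_mxM -eA scalemx1.
  by rewrite !det_mulmx mulrAC -det_mulmx PQ det1 mul1r.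
rewrite char_poly_trig ?diag_mx_is_trig //.
by apply: eq_bigr => i _; rewrite mxE eqxx mulr1n.
Qed.

Lemma frame_op_ge0 n (F : 'I_n -> 'cV[C]_d) x :
  0 <= inner (frame_op F *m x) x.
Proof.
have ipE (y z : 'cV[C]_d) : inner y z = (z^t* *m y) 0 0.
  by rewrite innerE mxE; apply: eq_bigr => i _; rewrite !mxE mulrC.
rewrite ipE /frame_op mulmx_suml mulmx_sumr summxE.
apply: sumr_ge0 => i _; rewrite tensorE -scalemxAr mxE -ipE.
have -> : inner (F i) x = (inner x (F i))^*%R.
  rewrite !innerE rmorph_sum; apply: eq_bigr => s _.
  by rewrite rmorphM /= conjCK mulrC.
by rewrite mul_conjC_ge0.
Qed.

Lemma frame_op_herm n (F : 'I_n -> 'cV[C]_d) : (frame_op F)^t* = frame_op F.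
Proof.
rewrite /frame_op; apply/matrixP => i j; rewrite !mxE !summxE rmorph_sum /=.
apply: eq_bigr => s _; rewrite !mxE rmorph_sum /=; apply: eq_bigr => u _.
by rewrite !mxE rmorphM /= conjCK mulrC.
Qed.

Lemma spectral_diag_ge0 (A : 'M[C]_d) : A \is normalmx ->
  (forall x, 0 <= inner (A *m x) x) -> forall i, 0 <= spectral_diag A 0 i.
Proof.
move=> /orthomx_spectralP eA A_ge0 i; have uQ := spectral_unit A.
have /unitarymxP QQ := spectral_unitarymx A.
have := A_ge0 (col i ((spectralmx A)^t*)).
have -> : A *m col i ((spectralmx A)^t*)
          = spectral_diag A 0 i *: col i ((spectralmx A)^t*).
  rewrite !colE mulmxA {1}eA -!mulmxA [spectralmx A *m (_ *m _)]mulmxA QQ mul1mx.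
  rewrite invmx_unitary ?spectral_unitarymx // scalemxAr; congr (_ *m _).
  by apply/colP => j; rewrite mul_diag_mx !mxE; case: eqP => [->|_] //; rewrite ?mulr0.
set v := col _ _.
have -> : inner (spectral_diag A 0 i *: v) v = spectral_diag A 0 i * inner v v.
  by rewrite !innerE mulr_sumr; apply: eq_bigr => j _; rewrite !mxE mulrA.
suff -> : inner v v = 1 by rewrite mulr1.
have := congr1 (fun M : 'M[C]_d => M i i) QQ; rewrite !mxE eqxx innerE => /esym e.
by rewrite [RHS]e; apply: eq_bigr => j _; rewrite !mxE conjCK mulrC.
Qed.

Lemma PsiE (phi : R -> R) n0 k (F0 : 'I_n0 -> 'cV[C]_d) (G : 'I_k -> 'cV[C]_d) :
  let S := frame_op F0 + frame_op G in
  [/\ Psi phi F0 G = \sum_i phi (complex.Re (spectral_diag S 0 i)),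
      forall i, 0 <= spectral_diag S 0 i
    & char_poly S = \prod_i ('X - (spectral_diag S 0 i)%:P)].
Proof.
move=> S; have nS : S \is normalmx.
  apply/normalmxP; suff -> : S^t* = S by [].
  by rewrite linearD map_mxD /= !frame_op_herm.
split; [by rewrite /Psi tr_fun_mx| |exact: char_poly_spectral].
apply: spectral_diag_ge0 => // x; suff -> : inner (S *m x) x =
    inner (frame_op F0 *m x) x + inner (frame_op G *m x) x.
  by rewrite addr_ge0 ?frame_op_ge0.
rewrite mulmxDl !innerE -big_split; apply: eq_bigr => i _.
by rewrite mxE mulrDl.
Qed.

End Facts.

(* Main.v *)
Require Import Defs.
From mathcomp Require Import all_boot all_order all_algebra.
From mathcomp Require Import sesquilinear spectral reals complex ring lra.
Import Order.TTheory GRing.Theory Num.Theory.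
Local Open Scope complex_scope.
Local Open Scope ring_scope.
Local Open Scope sesquilinear_scope.
Set Implicit Arguments.
Unset Strict Implicit.
Unset Printing Implicit Defensive.

(**
Let S0 be the frame operator of the given vectors, B = G G^* that of a local
minimizer with columns g_t, and S = S0 + B.  The potential A |-> tr phi(A) is
strictly convex on positive semidefinite matrices and invariant under unitary
conjugation [potential_sconvex, potential_unitary], so it decreases strictly
when S is replaced by a proper average of unitary conjugates of S.  Since phi
may have kinks, a derivative of the potential is not available; instead, each
structural property of the local minimizer comes from an explicit, arbitrarily
small, norm preserving perturbation of the columns which, if the property
failed, would turn S exactly into such an average (up to a unitary
conjugation):

- each g_t is an eigenvector of S, with eigenvalue c_t say [localmin_eigen]:
  otherwise g_t can be moved towards the bottom eigenvector of S - g_t g_t^*;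
- consequently S and B commute, and one can work in a common orthonormal
  eigenbasis, with eigenvalues nu_i of S, mu_i of B, al_i = nu_i - mu_i of S0;
- if mu_i > 0 and nu_l < nu_i then al_i <= al_l [localmin_opposite]: otherwise
  B can be turned in the plane of the two eigenvectors, by a map that rotates
  them through small angles, in general different ones;
- the g_t with c_t > nu_l are linearly independent [localmin_independent]:
  along a linear relation between them, mass can be moved to the l-th
  eigenvector without any first order effect on B.

These properties already force global minimality.  Let S' = S0 + G' G'^* come
from a competitor with columns g'_t.  By Karamata's inequality [karamata] it
is enough to compare, for each h, the sums over the spectra of S' and of S of
the hinge function x |-> max(x - h, 0).  For S this is the sum of nu_i - h over
E = {i | nu_i > h}.  Let J = {t | c_t > h}.  By linear independence, J has at
most as many elements as {i in E | mu_i > 0}, so some space of dimension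
exactly #|E| contains the eigenvectors with i in E and mu_i = 0 together with
the g'_t for t in J.  If P is the projection on this space, then
tr (P G' G'^* ) is at least the sum of the |g'_t|^2 = |g_t|^2 over J, which is
the sum of the mu_i over E, and tr (P S0) is at least the sum of the al_i over
E, by [localmin_opposite]: the eigenvectors with i in E and mu_i > 0 belong to
the lowest eigenvalues of S0 among those left.  The variational bound
[ky_fan_hinge] concludes. *)

(** * Convex functions of a real variable *)

Section Scalar.
Variable R : realType.
Implicit Types (x y z : R).

Lemma separate_point l (s : seq R) :
  (forall r, r \in s -> l < r) -> exists2 c, l < c & forall r, r \in s -> c < r.
Proof.
elim: s => [|r s IH] ls; first by exists (l + 1) => //; lra.
have [|c lc cs] := IH; first by move=> r' r's; apply: ls; rewrite inE r's orbT.
have lr : l < r by apply: ls; rewrite inE eqxx.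
exists (Num.min c ((l + r) / 2)); first by rewrite lt_min lc; lra.
move=> r'; rewrite inE gt_min => /predU1P[->|/cs ->//].
by apply/orP; right; lra.
Qed.

Lemma separate_seq (s t : seq R) :
  (forall l r, l \in s -> r \in t -> l < r) ->
  exists2 c, forall l, l \in s -> l < c & forall r, r \in t -> c < r.
Proof.
elim: s => [|l s IH] st.
  elim: t st => [|r t IHt] st; first by exists 0.
  have [//|c _ ct] := IHt; exists (Num.min c (r - 1)) => // r'.
  rewrite inE gt_min => /predU1P[->|/ct ->//].
  by apply/orP; right; lra.
have [|c sc ct] := IH; first by move=> l' r l's; apply: st; rewrite inE l's orbT.
have [|c' c'c c't] := @separate_point (Num.max l c) t.
  by move=> r rt; rewrite gt_max ct // st // inE eqxx.
move: c'c; rewrite gt_max => /andP[lc' cc'].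
by exists c' => // l'; rewrite inE => /predU1P[->//|/sc/lt_trans]; apply.
Qed.

Variable phi : R -> R.
Hypothesis phi_sconvex : strictly_convex_nonneg phi.

Lemma slope_lt x y z : 0 <= x -> x < y -> y < z ->
  (phi y - phi x) / (y - x) < (phi z - phi y) / (z - y).
Proof.
move=> x0 xy yz; have [yx0 zy0 zx0] : [/\ 0 < y - x, 0 < z - y & 0 < z - x].
  by split; lra.
have := @phi_sconvex x z ((z - y) / (z - x)) x0.
have -> : (z - y) / (z - x) * x + (1 - (z - y) / (z - x)) * z = y.
  by field; rewrite gt_eqF.
rewrite ltr_pdivrMr // mul1r divr_gt0 //.
have -> : (z - y < z - x) = true by lra.
move=> /(_ _ _ isT) conv; rewrite ltr_pdivrMr // mulrAC ltr_pdivlMr //.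
have /conv : 0 <= z by lra.
rewrite -(ltr_pM2r zx0) lt_eqF; last by lra.
move=> /(_ isT).
have -> : ((z - y) / (z - x) * phi x + (1 - (z - y) / (z - x)) * phi z) * (z - x)
   = (z - y) * phi x + (y - x) * phi z by field; rewrite gt_eqF.
by nra.
Qed.

(** A supporting line only has to be tested on finitely many points.  At x = 0 a
    genuine one need not exist, because phi may have slope -oo there or jump
    down just after 0. *)
Lemma tangent_seq (s : seq R) x : 0 <= x ->
  exists c, forall y, y \in s -> 0 <= y -> y != x -> phi x + c * (y - x) < phi y.
Proof.
move=> x0; pose slope y := (phi y - phi x) / (y - x).
have [|c lc rc] := @separate_seq [seq slope y | y <- s & (0 <= y) && (y < x)]
                               [seq slope y | y <- s & x < y].
  move=> _ _ /mapP[y + ->] /mapP[z + ->].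
  rewrite !mem_filter => /andP[/andP[y0 yx] _] /andP[xz _].
  have <- : (phi x - phi y) / (x - y) = slope y.
    by rewrite /slope -opprB -[x - y]opprB invrN mulrNN.
  exact: slope_lt.
exists c => y ys y0; rewrite neq_lt => /orP[yx|xy].
  have /lc : slope y \in [seq slope y | y <- s & (0 <= y) && (y < x)].
    by apply: map_f; rewrite mem_filter y0 yx.
  rewrite /slope ltr_ndivrMr; last by lra.
  by lra.
have /rc : slope y \in [seq slope y | y <- s & x < y].
  by apply: map_f; rewrite mem_filter xy.
rewrite /slope ltr_pdivlMr; last by lra.
by lra.
Qed.

Lemma jensen n (w l : 'I_n -> R) : (forall k, 0 <= w k) -> \sum_k w k = 1 ->
  (forall k, 0 <= l k) -> let m := \sum_k w k * l k in
  phi m <= \sum_k w k * phi (l k) /\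
  (\sum_k w k * phi (l k) <= phi m -> forall k, w k * (l k - m) = 0).
Proof.
move=> w0 w1 l0 m; have m0 : 0 <= m by apply: sumr_ge0 => k _; rewrite mulr_ge0.
have [c tan] := tangent_seq (codom l) m0.
have tank k : w k * (phi m + c * (l k - m)) <= w k * phi (l k).
  rewrite ler_wpM2l //; have [->|lm] := eqVneq (l k) m; first by lra.
  by rewrite ltW // tan // codom_f.
have summ : \sum_k w k * (phi m + c * (l k - m)) = phi m.
  transitivity (\sum_k ((phi m - c * m) * w k + c * (w k * l k))).
    by apply: eq_bigr => k _; ring.
  by rewrite big_split /= -!mulr_sumr w1 -/m; ring.
split; first by rewrite -summ ler_sum.
move=> le k; apply/eqP/negPn/negP; rewrite mulf_eq0 negb_or subr_eq0 => /andP[wk lk].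
have: \sum_k w k * (phi m + c * (l k - m)) < \sum_k w k * phi (l k).
  rewrite (bigD1 k) //= [ltRHS](bigD1 k) //= ltr_leD ?ler_sum //.
  by rewrite ltr_pM2l ?tan ?codom_f // lt_neqAle eq_sym wk w0.
by rewrite summ ltNge le.
Qed.

(** On the finite set of all values x i and y i, phi agrees with an affine
    function plus nonnegative multiples of hinge functions: read the values in
    increasing order and correct the slope at each of them, convexity making
    every correction nonnegative.  The inequality for phi is then the sum of the
    inequalities for these pieces. *)
Lemma karamata n (x y : 'I_n -> R) :
  (forall i, 0 <= x i) -> (forall i, 0 <= y i) ->
  \sum_i x i = \sum_i y i ->
  (forall t, \sum_i Num.max (y i - t) 0 <= \sum_i Num.max (x i - t) 0) ->
  \sum_i phi (y i) <= \sum_i phi (x i).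
Proof.
move=> x0 y0 xy hinge.
pose good (f : R -> R) := \sum_i f (y i) <= \sum_i f (x i).
have good_affine a b : good (fun t => a + b * t).
  by rewrite /good !big_split /= -!mulr_sumr xy.
have good_hinge f k t : 0 <= k -> good f ->
    good (fun u => f u + k * Num.max (u - t) 0).
  move=> k0 gf; rewrite /good !big_split /= -!mulr_sumr.
  by apply: lerD => //; rewrite ler_wpM2l.
suff [f gf ef] : exists2 f, good f &
    forall t, t \in codom x ++ codom y -> f t = phi t.
  have sumf (z : 'I_n -> R) : (forall i, z i \in codom x ++ codom y) ->
      \sum_i phi (z i) = \sum_i f (z i).
    by move=> zs; apply: eq_bigr => i _; rewrite ef.
  by rewrite !sumf // => i; rewrite mem_cat codom_f ?orbT.
suff [f gf ef] : exists2 f, good f &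
    forall t, t \in sort <=%R (undup (codom x ++ codom y)) -> f t = phi t.
  by exists f => // t ts; rewrite ef // mem_sort mem_undup.
have : sorted <%R (sort <=%R (undup (codom x ++ codom y))).
  by rewrite sort_lt_sorted undup_uniq.
have : {in sort <=%R (undup (codom x ++ codom y)), forall t, 0 <= t}.
  by move=> t; rewrite mem_sort mem_undup mem_cat => /orP[]/codomP[i ->].
case: (sort _ _) => [|u [|v s]].
- by exists (fun=> 0) => //; have := good_affine 0 0; congr (_ <= _);
    apply: eq_bigr => i _; ring.
- move=> _ _; exists (fun t => phi u + 0 * t) => // t.
  by rewrite inE => /eqP->; ring.
move=> /[dup] pos0 /(_ u); rewrite inE eqxx => /(_ isT) u0 /= /andP[uv].
have {pos0} : {in s, forall t, 0 <= t}.
  by move=> t ts; apply: pos0; rewrite !inE ts !orbT.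
pose aff t := phi u + (phi v - phi u) / (v - u) * (t - u).
have gaff : good aff.
  rewrite /good; have := good_affine (phi u - (phi v - phi u) / (v - u) * u)
    ((phi v - phi u) / (v - u)).
  by congr (_ <= _); apply: eq_bigr => i _; rewrite /aff; ring.
(* us lists the points treated so far: f interpolates phi on them and is affine
   beyond u, the one that precedes the last, v; s lists the points to come. *)
suff: forall (f : R -> R) (us : seq R) u v s, 0 <= u -> u < v -> good f ->
    {in us, forall t, f t = phi t} -> {in us, forall t, t <= v} ->
    (forall t, u <= t -> f t = phi u + (phi v - phi u) / (v - u) * (t - u)) ->
    path <%R v s ->
    exists2 g, good g & {in us ++ s, forall t, g t = phi t}.
  move=> /(_ aff [:: u; v] u v s) ind _ vs.
  case: ind => //.
  + move=> t; rewrite !inE /aff => /orP[]/eqP->; first by ring.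
    by field; lra.
  + by move=> t; rewrite !inE => /orP[]/eqP->; lra.
  by move=> g gg eg; exists g.
clear aff gaff u0 uv; move=> {}f us {}u {}v {}s.
elim: s f us u v => [|w s IH] f us {}u {}v u0 uv gf ef lev fu.
  by exists f => //; rewrite cats0.
move=> /= /andP[vw ws].
pose k := (phi w - phi v) / (w - v) - (phi v - phi u) / (v - u).
have k0 : 0 <= k by rewrite /k subr_ge0 ltW // slope_lt.
have v0 : 0 <= v by lra.
rewrite -cat_rcons.
have fbeyond t : v <= t -> f t + k * Num.max (t - v) 0 =
    phi v + (phi w - phi v) / (w - v) * (t - v).
  move=> vt; rewrite fu; last by lra.
  have -> : Num.max (t - v) 0 = t - v by apply/max_idPl; lra.
  by rewrite /k; field; apply/andP; split; lra.
apply: (IH (fun t => f t + k * Num.max (t - v) 0) _ v w) => //.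
- exact: good_hinge.
- move=> t; rewrite mem_rcons inE => /predU1P[->|tus].
    by rewrite fbeyond; [field; lra|lra].
  rewrite (_ : Num.max _ _ = 0) ?mulr0 ?addr0 ?ef //.
  by apply/max_idPr; have := lev _ tus; lra.
- by move=> t; rewrite mem_rcons inE => /predU1P[->//|/lev]; lra.
Qed.

(** The cosine and the sine of a small angle with prescribed product A.  The
    product appears in the off-diagonal entries of a rotated frame operator,
    which have to be exact, while bounds on the square of the sine suffice. *)
Lemma small_rotation A : 0 <= A <= 1 / 4 -> exists p : R * R,
  [/\ 0 < p.1, 0 <= p.2, p.1 ^+ 2 + p.2 ^+ 2 = 1, p.1 * p.2 = A
    & A ^+ 2 <= p.2 ^+ 2 <= A ^+ 2 + 4 * A ^+ 4] /\
  (1 - p.1 <= 2 * A ^+ 2 /\ 1 / 2 <= p.1 ^+ 2).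
Proof.
move=> /andP[A0 A4].
have D0 : 0 <= 1 - 4 * A ^+ 2 by nra.
pose r := Num.sqrt (1 - 4 * A ^+ 2).
have r2 : r ^+ 2 = 1 - 4 * A ^+ 2 by rewrite sqr_sqrtr.
have r0 : 0 <= r by rewrite sqrtr_ge0.
have r1 : r <= 1 by rewrite -sqrtr1 ler_wsqrtr //; nra.
pose c := Num.sqrt ((1 + r) / 2); pose s := Num.sqrt ((1 - r) / 2).
have c2 : c ^+ 2 = (1 + r) / 2 by rewrite sqr_sqrtr //; lra.
have s2 : s ^+ 2 = (1 - r) / 2 by rewrite sqr_sqrtr //; lra.
have c0 : 0 < c by rewrite sqrtr_gt0; lra.
have s0 : 0 <= s by rewrite sqrtr_ge0.
exists (c, s) => /=; split; last first.
  split; last by rewrite c2; lra.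
  have c1 : c <= 1 by rewrite -sqrtr1 ler_wsqrtr //; lra.
  by nra.
split => //.
- by rewrite c2 s2; field.
- have /eqP : (c * s) ^+ 2 = A ^+ 2 by rewrite exprMn c2 s2; nra.
  by rewrite eqrXn2 // ?mulr_ge0 // ?(ltW c0) // => /eqP.
rewrite s2; apply/andP; split; first by nra.
have : (1 - r) / 2 <= 2 * A ^+ 2 by nra.
have -> : A ^+ 4 = (A ^+ 2) ^+ 2 by rewrite -exprM.
move: (A ^+ 2) r2 => B r2 h; nra.
Qed.

End Scalar.

(** * Conjugate transposes and unitary matrices *)

Section CTranspose.
Variable C : numClosedFieldType.

Lemma ctmx_mul m n p (A : 'M[C]_(m, n)) (B : 'M[C]_(n, p)) :
  (A *m B)^t* = B^t* *m A^t*.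
Proof. by rewrite trmx_mul map_mxM. Qed.

Lemma ctmxE m n (A : 'M[C]_(m, n)) i j : A^t* i j = (A j i)^*.
Proof. by rewrite !mxE. Qed.

Lemma ctmxD m n (A B : 'M[C]_(m, n)) : (A + B)^t* = A^t* + B^t*.
Proof. by rewrite linearD map_mxD. Qed.

Lemma ctmxB m n (A B : 'M[C]_(m, n)) : (A - B)^t* = A^t* - B^t*.
Proof. by apply/matrixP => i j; rewrite !mxE rmorphB. Qed.

Lemma ctmx1 n : (1%:M : 'M[C]_n)^t* = 1%:M.
Proof. by rewrite trmx1 map_mx1. Qed.

Lemma unitary_mulVmx n (U : 'M[C]_n) : U \is unitarymx -> U^t* *m U = 1%:M.
Proof. by move=> uU; rewrite -invmx_unitary // mulVmx // unitarymx_unit. Qed.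

Lemma unitary_mulmxV n (U : 'M[C]_n) : U \is unitarymx -> U *m U^t* = 1%:M.
Proof. by move=> /unitarymxP. Qed.

Lemma unitary_ctmx n (U : 'M[C]_n) : U \is unitarymx -> U^t* \is unitarymx.
Proof. by rewrite trmxC_unitary. Qed.

Lemma unitary_conjK n (U A : 'M[C]_n) : U \is unitarymx ->
  U^t* *m (U *m A *m U^t*) *m U = A.
Proof.
move=> uU; rewrite !mulmxA unitary_mulVmx // mul1mx -mulmxA unitary_mulVmx //.
by rewrite mulmx1.
Qed.

Lemma unitary_conjVK n (U A : 'M[C]_n) : U \is unitarymx ->
  U *m (U^t* *m A *m U) *m U^t* = A.
Proof.
by move=> uU; have := unitary_conjK A (unitary_ctmx uU); rewrite trmxCK.
Qed.

Lemma mxtrace_unitary n (U A : 'M[C]_n) : U \is unitarymx ->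
  \tr (U^t* *m A *m U) = \tr A.
Proof.
by move=> uU; rewrite mxtrace_mulC mulmxA unitary_mulmxV // mul1mx.
Qed.

Lemma ctmx_conj n (U A : 'M[C]_n) : A^t* = A -> (U *m A *m U^t*)^t* = U *m A *m U^t*.
Proof. by move=> hA; rewrite !ctmx_mul trmxCK hA mulmxA. Qed.

(** Both determinants arise from the block matrix with rows (c, A) and (B, 1),
    multiplied on the right or on the left by a block triangular matrix; the
    second way introduces the factor det c, which can be cancelled. *)
Lemma det_scalar_sub_mulmxC (D : idomainType) n (c : D) (A B : 'M[D]_n) : c != 0 ->
  \det (c%:M - A *m B) = \det (c%:M - B *m A).
Proof.
move=> c0; pose X := block_mx (c%:M : 'M_n) A B (1%:M : 'M_n).
have dX : \det X = \det (c%:M - A *m B).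
  have : X *m block_mx 1%:M 0 (- B) 1%:M = block_mx (c%:M - A *m B) A 0 1%:M.
    rewrite mulmx_block !mulmx1 !mulmx0 !mulmxN mul1mx !add0r.
    by rewrite subrr.
  move=> /(congr1 determinant); rewrite det_mulmx det_lblock det_ublock !det1.
  by rewrite !mulr1.
have : block_mx 1%:M 0 (- B) c%:M *m X = block_mx c%:M A 0 (c%:M - B *m A).
  rewrite mulmx_block !mul1mx !mul0mx !addr0 mulNmx mul_scalar_mx mul_mx_scalar.
  by rewrite addNr mulNmx mulmx1 addrC.
move=> /(congr1 determinant); rewrite det_mulmx det_lblock det_ublock det1 mul1r.
rewrite dX det_scalar => /mulfI; apply.
by rewrite expf_neq0.
Qed.

End CTranspose.

(** * The trace potential *)

Section Potential.
Variable R : realType.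
Local Notation C := R[i].

Definition nsq (z : C) : R := complex.Re z ^+ 2 + complex.Im z ^+ 2.

Lemma nsqE z : (nsq z)%:C = z * z^*.
Proof. by rewrite /nsq add_Re2_Im2 normCK. Qed.

Lemma nsq_ge0 z : 0 <= nsq z.
Proof. by rewrite addr_ge0 ?sqr_ge0. Qed.

Lemma nsq_eq0 z : (nsq z == 0) = (z == 0).
Proof. by rewrite -(inj_eq (@complexI R)) nsqE mul_conjC_eq0. Qed.

Lemma conjCR (x : R) : (x%:C)^* = x%:C :> C.
Proof. by apply/eqP; rewrite eq_complex /= oppr0 !eqxx. Qed.

Lemma conjCZ (x : R) (z : C) : (x%:C * z)^* = x%:C * z^*.
Proof. by rewrite rmorphM /= conjCR. Qed.

Lemma nsqM z w : nsq (z * w) = nsq z * nsq w.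
Proof.
by apply: complexI; rewrite rmorphM /= !nsqE rmorphM /= mulrACA.
Qed.

Lemma nsqR (x : R) : nsq x%:C = x ^+ 2.
Proof. by rewrite /nsq /= expr0n addr0. Qed.

Lemma ReM_real (x : R) (z : C) : complex.Re (x%:C * z) = x * complex.Re z.
Proof. by case: z => ? ?; rewrite /= mul0r subr0. Qed.

Variable d : nat.

Definition diagC (l : 'I_d -> R) : 'M[C]_d := diag_mx (\row_i (l i)%:C).

Definition psd (A : 'M[C]_d) :=
  A^t* = A /\ forall x : 'cV[C]_d, 0 <= (x^t* *m A *m x) 0 0.

Lemma diagCE l i j : diagC l i j = (l i)%:C *+ (i == j).
Proof. by rewrite !mxE. Qed.

Lemma ctmx_diagC l : (diagC l)^t* = diagC l.
Proof.
apply/matrixP => i j; rewrite ctmxE !diagCE eq_sym.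
by case: eqP => [->|]; rewrite ?mulr1n ?mulr0n ?conjCR ?conjC0.
Qed.

Lemma hermitian_spectral (A : 'M[C]_d) : A^t* = A ->
  exists P : 'M[C]_d, exists l : 'I_d -> R,
    P \is unitarymx /\ A = P^t* *m diagC l *m P.
Proof.
move=> hA; have nA : A \is normalmx by apply/normalmxP; rewrite hA.
have uP := spectral_unitarymx A.
have eA := orthomx_spectralP nA; rewrite invmx_unitary // in eA.
move: (spectralmx A) (spectral_diag A) uP eA => P m uP eA.
exists P, (fun i => complex.Re (m 0 i)); split=> //.
have eD : diag_mx m = P *m A *m P^t*.
  rewrite eA !mulmxA unitary_mulmxV // mul1mx -mulmxA unitary_mulmxV //.
  by rewrite mulmx1.
have hD : (diag_mx m)^t* = diag_mx m.
  by rewrite eD !ctmx_mul trmxCK hA mulmxA.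
suff em : \row_i (complex.Re (m 0 i))%:C = m by rewrite /diagC em.
apply/rowP => i; rewrite mxE.
have /matrixP/(_ i i) := hD; rewrite ctmxE !mxE eqxx !mulr1n => /CrealP h.
by rewrite RRe_real.
Qed.

Lemma psd_eig_ge0 (P : 'M[C]_d) l : P \is unitarymx ->
  psd (P^t* *m diagC l *m P) -> forall i, 0 <= l i.
Proof.
move=> uP [_ pos] i; have := pos (P^t* *m delta_mx i 0).
rewrite ctmx_mul trmxCK !mulmxA -(mulmxA _ P) unitary_mulmxV // mulmx1.
rewrite -(mulmxA _ P) unitary_mulmxV // mulmx1.
rewrite -mulmxA -colE mxE (bigD1 i) //= big1 => [|j ji].
  by rewrite ctmxE [col _ _ _ _]mxE diagCE !mxE !eqxx conjC1 mul1r addr0 ler0c.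
by rewrite ctmxE mxE (negPf ji) conjC0 mul0r.
Qed.

Lemma psd_conj (U A : 'M[C]_d) : psd A -> psd (U *m A *m U^t*).
Proof.
move=> [hA pos]; split; first by rewrite !ctmx_mul trmxCK hA mulmxA.
by move=> x; have := pos (U^t* *m x); rewrite ctmx_mul trmxCK !mulmxA.
Qed.

Lemma psdD (A B : 'M[C]_d) : psd A -> psd B -> psd (A + B).
Proof.
move=> [hA pA] [hB pB]; split; first by rewrite ctmxD hA hB.
by move=> x; rewrite mulmxDr mulmxDl mxE addr_ge0.
Qed.

Lemma psdZ (c : R) (A : 'M[C]_d) : 0 <= c -> psd A -> psd (c%:C *: A).
Proof.
move=> c0 [hA pA]; split; first by rewrite linearZ map_mxZ /= hA conjCR.
by move=> x; rewrite -scalemxAr -scalemxAl mxE mulr_ge0 // ler0c.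
Qed.

Lemma psd_gram n (M : 'M[C]_(d, n)) : psd (M *m M^t*).
Proof.
split; first by rewrite ctmx_mul trmxCK.
move=> x; rewrite mulmxA -mulmxA -[x in M^t* *m x]trmxCK -ctmx_mul mxE.
by apply: sumr_ge0 => j _; rewrite ctmxE mul_conjC_ge0.
Qed.

Lemma psd_diagC l : (forall i, 0 <= l i) -> psd (diagC l).
Proof.
move=> l0; split; first exact: ctmx_diagC.
move=> x; rewrite -mulmxA mul_diag_mx mxE sumr_ge0 // => i _.
rewrite ctmxE !mxE mulrCA; apply: mulr_ge0; first by rewrite ler0c.
by rewrite mulrC mul_conjC_ge0.
Qed.

Variable phi : R -> R.
Hypothesis phi_sconvex : strictly_convex_nonneg phi.

Definition potential (A : 'M[C]_d) : R := complex.Re (\tr (fun_mx phi A)).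

Lemma potential_spectral (P : 'M[C]_d) l : P \is unitarymx ->
  potential (P^t* *m diagC l *m P) = \sum_i phi (l i).
Proof.
move=> uP; have nA : P^t* *m diagC l *m P \is normalmx.
  apply/normalmxP; suff -> : (P^t* *m diagC l *m P)^t* = P^t* *m diagC l *m P by [].
  by have := ctmx_conj (P^t*) (ctmx_diagC l); rewrite trmxCK.
rewrite /potential (@fun_mxE _ _ phi _ P (\row_i (l i)%:C) uP nA).
  rewrite (invmx_unitary uP) (mxtrace_unitary _ uP) mxtrace_diag.
  rewrite raddf_sum /=; apply: eq_bigr => i _.
  by rewrite !mxE /=.
by rewrite (invmx_unitary uP).
Qed.

Lemma potential_unitary (U A : 'M[C]_d) : U \is unitarymx -> A^t* = A ->
  potential (U *m A *m U^t*) = potential A.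
Proof.
move=> uU /hermitian_spectral[P [l [uP ->]]]; rewrite potential_spectral //.
have := potential_spectral l (mul_unitarymx uP (unitary_ctmx uU)).
by rewrite ctmx_mul trmxCK !mulmxA.
Qed.

Lemma unitary_row_nsq (W : 'M[C]_d) i : W \is unitarymx -> \sum_k nsq (W i k) = 1.
Proof.
move=> /unitarymxP/matrixP/(_ i i); rewrite !mxE eqxx => e.
apply: complexI; rewrite rmorph_sum rmorph1 -[RHS]e; apply: eq_bigr => k _ /=.
by rewrite ctmxE -nsqE.
Qed.

Lemma nsq_conj z : nsq (z^*) = nsq z.
Proof. by apply: complexI; rewrite !nsqE conjCK mulrC. Qed.

Lemma unitary_col_nsq (W : 'M[C]_d) k : W \is unitarymx -> \sum_i nsq (W i k) = 1.
Proof.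
move=> /unitary_ctmx uW; rewrite -(unitary_row_nsq k uW); apply: eq_bigr => i _.
by rewrite ctmxE nsq_conj.
Qed.

(** The diagonal of A in any orthonormal basis is the image of the spectrum of A
    under a doubly stochastic matrix, so this is Jensen's inequality summed over
    the basis.  When equality holds, each basis vector only meets eigenvectors
    of a single eigenvalue, that is, the basis diagonalizes A. *)
Lemma peierls (A P : 'M[C]_d) : psd A -> P \is unitarymx ->
  let p i := complex.Re ((P *m A *m P^t*) i i) in
  \sum_i phi (p i) <= potential A /\
  (potential A <= \sum_i phi (p i) -> P *m A *m P^t* = diagC p).
Proof.
move=> pA uP; have [hA _] := pA.
have [Q [l [uQ eA]]] := hermitian_spectral hA.
have l0 : forall i, 0 <= l i by apply: (psd_eig_ge0 uQ); rewrite -eA.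
set N := P *m A *m P^t*; move=> p.
pose W := P *m Q^t*.
have uW : W \is unitarymx by exact: (mul_unitarymx uP (unitary_ctmx uQ)).
have NE i j : N i j = \sum_k (l k)%:C * (W i k * (W j k)^*).
  have -> : N = W *m diagC l *m W^t*.
    by rewrite /W ctmx_mul trmxCK /N eA !mulmxA.
  rewrite mul_mx_diag mxE; apply: eq_bigr => k _.
  by rewrite ctmxE !mxE mulrAC mulrC.
have pE i : p i = \sum_k nsq (W i k) * l k.
  rewrite /p NE raddf_sum; apply: eq_bigr => k _ /=.
  by rewrite -nsqE -rmorphM /= mulrC.
have jen i := jensen phi_sconvex (fun k => nsq_ge0 (W i k)) (unitary_row_nsq i uW) l0.
have potE : potential A = \sum_i \sum_k nsq (W i k) * phi (l k).
  rewrite eA potential_spectral // exchange_big /=; apply: eq_bigr => k _.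
  by rewrite -mulr_suml unitary_col_nsq // mul1r.
have le i : phi (p i) <= \sum_k nsq (W i k) * phi (l k).
  by rewrite pE; case: (jen i).
rewrite potE; split; first by apply: ler_sum => i _; exact: le.
move=> ge; apply/matrixP => i j; rewrite diagCE NE.
have Wl k : W i k * (l k)%:C = W i k * (p i)%:C.
  have [->|W0] := eqVneq (W i k) 0; first by rewrite !mul0r.
  have : \sum_k nsq (W i k) * phi (l k) <= phi (p i).
    rewrite leNgt; apply/negP => lt.
    move: ge; apply/negP; rewrite -ltNge (bigD1 i) //= [ltRHS](bigD1 i) //=.
    by rewrite ltr_leD // ler_sum.
  rewrite pE; case: (jen i) => _ /[apply] /(_ k) /eqP.
  by rewrite mulf_eq0 nsq_eq0 (negPf W0) subr_eq0 => /= /eqP->.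
transitivity ((p i)%:C * (W *m W^t*) i j).
  rewrite mxE mulr_sumr; apply: eq_bigr => k _.
  by rewrite ctmxE mulrA (mulrC _ (W i k)) Wl -mulrA mulrCA.
by rewrite unitary_mulmxV // mxE mulr_natr.
Qed.

(** In an eigenbasis of the average X, the eigenvalues of X are the averages of
    the diagonals of A and B, and Peierls' inequality bounds each of these two
    diagonals.  If nothing is lost in either step, A and B are both diagonal in
    this basis, with the same diagonal. *)
Lemma potential_sconvex (A B : 'M[C]_d) (t : R) : psd A -> psd B -> A != B ->
  0 < t < 1 ->
  potential (t%:C *: A + (1 - t)%:C *: B) < t * potential A + (1 - t) * potential B.
Proof.
move=> pA pB AB t01; have /andP[t0 t1] := t01.
set X := _ + _; have pX : psd X.
  by apply: psdD; apply: psdZ => //; lra.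
have [P [l [uP eX]]] := hermitian_spectral pX.1.
have eD : diagC l = P *m X *m P^t*.
  by rewrite eX unitary_conjVK.
have [peA eqA] := peierls pA uP; have [peB eqB] := peierls pB uP.
move: peA eqA peB eqB.
set a := fun i => complex.Re _; set b := fun i => complex.Re _.
move=> peA eqA peB eqB.
have lE i : l i = t * a i + (1 - t) * b i.
  have := congr1 (fun M : 'M_d => complex.Re (M i i)) eD.
  rewrite diagCE eqxx mulr1n /= => ->.
  rewrite /X mulmxDr mulmxDl -!scalemxAr -!scalemxAl /a /b.
  move: (P *m A *m P^t*) (P *m B *m P^t*) => Ma Mb; rewrite !mxE raddfD /=.
  by congr (_ + _); rewrite ReM_real.
have diag_ge0 (M : 'M[C]_d) i : psd M -> 0 <= complex.Re ((P *m M *m P^t*) i i).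
  move=> pM; have [_ pos] := psd_conj P pM; have := pos (delta_mx i 0).
  rewrite -mulmxA -colE mxE (bigD1 i) //= big1 => [|j ji].
    rewrite ctmxE mxE !eqxx conjC1 mul1r addr0 mxE.
    by case: (_ i i) => x y; rewrite lecE /= => /andP[].
  by rewrite ctmxE mxE (negPf ji) conjC0 mul0r.
have a0 i : 0 <= a i by exact: diag_ge0.
have b0 i : 0 <= b i by exact: diag_ge0.
rewrite eX potential_spectral //.
have le i : phi (l i) <= t * phi (a i) + (1 - t) * phi (b i).
  rewrite lE; have [->|ab] := eqVneq (a i) (b i); last exact/ltW/phi_sconvex.
  have e (u : R) : t * u + (1 - t) * u = u by ring.
  by rewrite !e.
have leS : \sum_i phi (l i) <= t * (\sum_i phi (a i)) + (1 - t) * (\sum_i phi (b i)).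
  by rewrite !mulr_sumr -big_split ler_sum.
have t1' : 0 < 1 - t by rewrite subr_gt0.
have [/existsP[i ab]|] := boolP [exists i, a i != b i].
  apply: (@lt_le_trans _ _ (t * (\sum_i phi (a i)) + (1 - t) * (\sum_i phi (b i)))).
    rewrite !mulr_sumr -big_split (bigD1 i) //= [ltRHS](bigD1 i) //=.
    by rewrite ltr_leD ?ler_sum // lE phi_sconvex.
  exact: (lerD (ler_wpM2l (ltW t0) peA) (ler_wpM2l (ltW t1') peB)).
rewrite negb_exists => /forallP ab.
have eab : diagC a = diagC b.
  by congr diag_mx; apply/rowP => i; rewrite !mxE (eqP (negPn (ab i))).
apply: (le_lt_trans leS).
have [lta|/eqA eqa] := ltP (\sum_i phi (a i)) (potential A).
  apply: ltr_leD; first by rewrite ltr_pM2l.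
  exact: (ler_wpM2l (ltW t1') peB).
have [ltb|/eqB eqb] := ltP (\sum_i phi (b i)) (potential B).
  apply: ler_ltD; last by rewrite ltr_pM2l.
  exact: (ler_wpM2l (ltW t0) peA).
suff /eqP : A = B by rewrite (negPf AB).
transitivity (P^t* *m diagC a *m P); first by rewrite -eqa (unitary_conjK A uP).
by rewrite eab -eqb (unitary_conjK B uP).
Qed.

Lemma potential_char_poly (A B : 'M[C]_d) : A^t* = A -> B^t* = B ->
  char_poly A = char_poly B -> potential A = potential B.
Proof.
have nh (M : 'M[C]_d) : M^t* = M -> M \is normalmx.
  by move=> hM; apply/normalmxP; rewrite hM.
move=> /nh nA /nh nB.
rewrite (char_poly_spectral nA) (char_poly_spectral nB) => e.
rewrite /potential !tr_fun_mx /=.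
have {}e : perm_eq (codom (spectral_diag A 0)) (codom (spectral_diag B 0)).
  apply: prod_XsubC_eq; rewrite /codom /image_mem !big_map -!enumT.
  by move: e; rewrite -!big_enum.
have sumE (M : 'M[C]_d) : \sum_i phi (complex.Re (spectral_diag M 0 i)) =
    \sum_(z <- codom (spectral_diag M 0)) phi (complex.Re z).
  by rewrite /codom /image_mem big_map -big_enum.
by rewrite !sumE; apply: perm_big.
Qed.

(** M M^* and M^* M have the same characteristic polynomial. *)
Lemma potential_gramC (M : 'M[C]_d) (c : R) :
  potential (c%:C%:M + M *m M^t*) = potential (c%:C%:M + M^t* *m M).
Proof.
have hc : (c%:C%:M : 'M[C]_d)^t* = c%:C%:M by rewrite tr_scalar_mx map_scalar_mx /= conjCR.
apply: potential_char_poly.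
- by rewrite ctmxD ctmx_mul trmxCK hc.
- by rewrite ctmxD ctmx_mul trmxCK hc.
rewrite /char_poly /char_poly_mx !map_mxD !map_mxM /= !map_scalar_mx /=.
rewrite !opprD !addrA -raddfB /=; apply: det_scalar_sub_mulmxC.
by rewrite polyXsubC_eq0.
Qed.

End Potential.

(** * Perturbations that decrease the potential *)

Section Plane.
Variable C : numClosedFieldType.

Lemma plane_unitary d m (X : 'M[C]_(d, m)) (w : 'M[C]_m) :
  X^t* *m X = 1%:M -> w \is unitarymx ->
  1%:M + X *m (w - 1%:M) *m X^t* \is unitarymx.
Proof.
move=> XX uw; apply/unitarymxP.
have : (w - 1%:M) *m (w - 1%:M)^t* = - ((w - 1%:M)^t* + (w - 1%:M)).
  rewrite ctmxB ctmx1 mulmxBr mulmx1 mulmxBl unitary_mulmxV // mul1mx.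
  by apply/matrixP => i j; rewrite !mxE; ring.
move: (w - 1%:M) => v vv.
rewrite ctmxD ctmx1 !ctmx_mul trmxCK mulmxDl mul1mx mulmxDr mulmx1.
have -> : X *m v *m X^t* *m (X *m (v^t* *m X^t*)) = X *m (v *m v^t*) *m X^t*.
  by rewrite !mulmxA -(mulmxA _ (X^t*)) XX mulmx1.
rewrite vv mulmxN mulNmx mulmxDr mulmxDl mulmxA.
move: (X *m v *m _) (X *m v^t* *m _) => E F.
by apply/matrixP => i j; rewrite !mxE; ring.
Qed.

(** The map that acts as w on the range of the isometry X and fixes the
    orthogonal complement changes S only within that range, provided that the
    range is invariant under S.  The matrix w is arbitrary: besides unitary
    ones, the proof of [localmin_opposite] uses one that merely has unit
    columns. *)
Lemma plane_conj d m (S : 'M[C]_d) (X : 'M[C]_(d, m)) (D w : 'M[C]_m) :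
  X^t* *m X = 1%:M -> S^t* = S -> D^t* = D -> S *m X = X *m D ->
  let U := 1%:M + X *m (w - 1%:M) *m X^t* in
  U *m S *m U^t* = S + X *m (w *m D *m w^t* - D) *m X^t*.
Proof.
move=> XX hS hD SX U.
have XS : X^t* *m S = D *m X^t* by rewrite -{1}hS -ctmx_mul SX ctmx_mul hD.
have -> : U *m S = S + X *m (w *m D - D) *m X^t*.
  by rewrite mulmxDl mul1mx -mulmxA XS mulmxA -(mulmxA X) mulmxBl mul1mx.
have -> : U^t* = 1%:M + X *m (w^t* - 1%:M) *m X^t*.
  rewrite ctmxD ctmx1 !ctmx_mul trmxCK mulmxA.
  by rewrite ctmxB ctmx1.
rewrite mulmxDr mulmx1 mulmxDl.
have -> : S *m (X *m (w^t* - 1%:M) *m X^t*) = X *m (D *m w^t* - D) *m X^t*.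
  by rewrite !mulmxA SX -(mulmxA X) mulmxBr mulmx1.
have -> : X *m (w *m D - D) *m X^t* *m (X *m (w^t* - 1%:M) *m X^t*) =
          X *m (w *m D *m w^t* - w *m D - D *m w^t* + D) *m X^t*.
  rewrite !mulmxA -(mulmxA _ (X^t*)) XX mulmx1 -(mulmxA X).
  congr (X *m _ *m _).
  by rewrite mulmxBl !mulmxBr !mulmx1 opprB addrA [RHS]addrAC.
rewrite -addrA; congr (S + _); rewrite -!mulmxDl -!mulmxDr; congr (X *m _ *m _).
by apply/matrixP => i j; move: (w *m D) (D *m w^t*) (w *m D *m w^t*) => E F H;
  rewrite !mxE; ring.
Qed.

End Plane.

Section RealPlane.
Variable R : realType.
Local Notation C := R[i].
Implicit Types a b c e : R.

(** The real 2 x 2 matrix with rows (a, b) and (c, e), seen over the complex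
    numbers. *)
Definition rmx a b c e : 'M[C]_2 :=
  \matrix_(i, j) (if i == 0 then (if j == 0 then a else b)
                  else (if j == 0 then c else e))%:C.

Lemma rmxM a b c e a' b' c' e' :
  rmx a b c e *m rmx a' b' c' e' =
  rmx (a * a' + b * c') (a * b' + b * e') (c * a' + e * c') (c * b' + e * e').
Proof.
apply/matrixP => i j; rewrite !mxE !big_ord_recl big_ord0 !mxE /= addr0.
by rewrite -!rmorphM -rmorphD; case: (i == 0); case: (j == 0).
Qed.

Lemma rmx_ct a b c e : (rmx a b c e)^t* = rmx a c b e.
Proof.
apply/matrixP => i j; rewrite !mxE conjCR.
by case: (i == 0); case: (j == 0).
Qed.

Lemma rmx1 : 1%:M = rmx 1 0 0 1.
Proof. by apply/matrixP => -[[|[|//]] ?] [[|[|//]] ?]; rewrite !mxE. Qed.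

Lemma rmxB a b c e a' b' c' e' :
  rmx a b c e - rmx a' b' c' e' = rmx (a - a') (b - b') (c - c') (e - e').
Proof.
apply/matrixP => i j; rewrite !mxE -rmorphB.
by case: (i == 0); case: (j == 0).
Qed.

Lemma rmxZ x a b c e : x%:C *: rmx a b c e = rmx (x * a) (x * b) (x * c) (x * e).
Proof.
apply/matrixP => i j; rewrite !mxE -rmorphM.
by case: (i == 0); case: (j == 0).
Qed.

End RealPlane.

Section Descent.
Variables (R : realType) (d : nat).
Local Notation C := R[i].
Variable phi : R -> R.
Hypothesis phi_sconvex : strictly_convex_nonneg phi.
Local Notation potential := (@potential R d phi).

(** With the trace of the 2 x 2 block fixed, the condition on tau and o says that
    its determinant grows: its two eigenvalues get strictly closer.  The new
    matrix lies on the segment from S to its image under a reflection of the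
    plane. *)
Lemma potential_two_level (S : 'M[C]_d) (X : 'M[C]_(d, 2)) (c1 c2 tau o : R) :
  psd S -> X^t* *m X = 1%:M -> S *m X = X *m rmx c1 0 0 c2 ->
  0 < tau -> tau ^+ 2 + o ^+ 2 < tau * (c1 - c2) ->
  potential (S + X *m rmx (- tau) o o tau *m X^t*) < potential S.
Proof.
move=> pS XX SX tau0 small.
set D := rmx _ _ _ _ in SX.
pose q := tau ^+ 2 + o ^+ 2.
have q0 : 0 < q by rewrite /q; nra.
pose r := Num.sqrt q; have r0 : 0 < r by rewrite sqrtr_gt0.
have r2 : r ^+ 2 = q by rewrite sqr_sqrtr // ltW.
(* The Hermitian 2 x 2 matrices with the eigenvalues c1 and c2 form a sphere, and
   w is the reflection that carries D to the second point where the line from D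
   through the target meets it; p is the position of the target on the chord. *)
pose w : 'M[C]_2 := rmx (o / r) (tau / r) (tau / r) (- (o / r)).
have wt : w^t* = w by rewrite rmx_ct.
have q1 : (o / r) ^+ 2 + (tau / r) ^+ 2 = 1.
  by rewrite !expr_div_n r2 -mulrDl addrC divff ?gt_eqF.
have uw : w \is unitarymx.
  by apply/unitarymxP; rewrite wt rmxM rmx1; congr rmx; rewrite -?q1; ring.
have hD : D^t* = D by rewrite rmx_ct.
have [hS _] := pS.
have eU := plane_conj w XX hS hD SX.
have uU := plane_unitary XX uw.
set U := 1%:M + _ in uU eU.
pose p := q / (tau * (c1 - c2)).
have c12 : 0 < tau * (c1 - c2) by apply: lt_trans small.
have p01 : 0 < 1 - p < 1.
  by rewrite subr_gt0 ltr_pdivrMr // mul1r small gtrBl divr_gt0.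
have eK : rmx (- tau) o o tau = p%:C *: (w *m D *m w^t* - D).
  rewrite wt !rmxM rmxB rmxZ !mulr0 !addr0 !add0r.
  have q_unit : q != 0 by rewrite gt_eqF.
  have t_unit : tau != 0 by rewrite gt_eqF.
  have c_unit : c1 - c2 != 0.
    by apply/eqP => e; move: c12; rewrite e mulr0 ltxx.
  have r_unit : r != 0 by rewrite gt_eqF.
  have sq (x y z : R) : x / r * z * (y / r) = x * y * z / q.
    by rewrite -r2; field.
  have sqN (x y z : R) : x / r * z * - (y / r) = - (x * y * z / q).
    by rewrite mulrN sq.
  have sNq (x y z : R) : - (x / r) * z * (y / r) = - (x * y * z / q).
    by rewrite !mulNr sq.
  have sNqN (x y z : R) : - (x / r) * z * - (y / r) = (x * y * z / q).
    by rewrite mulrN !mulNr opprK sq.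
  rewrite !(sq, sqN, sNq, sNqN).
  congr rmx; rewrite /p /q; field;
    by rewrite -/q q_unit t_unit c_unit.
have -> : S + X *m rmx (- tau) o o tau *m X^t* =
    (1 - p)%:C *: S + (1 - (1 - p))%:C *: (U *m S *m U^t*).
  rewrite eU eK -scalemxAr -scalemxAl; move: (X *m _ *m _) => Z.
  by apply/matrixP => i j; rewrite !mxE !rmorphB /=; ring.
have SU : S != U *m S *m U^t*.
  apply/eqP; rewrite eU => e.
  have Z0 : w *m D *m w^t* - D = 0.
    have /(congr1 (fun M => X^t* *m M *m X)) : X *m (w *m D *m w^t* - D) *m X^t* = 0.
      by apply: (@addrI _ S); rewrite addr0 -e.
    by rewrite mulmx0 mul0mx !mulmxA XX mul1mx -mulmxA XX mulmx1.
  have := congr1 (fun M : 'M_2 => complex.Re (M 0 0)) eK.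
  by rewrite Z0 scaler0 !mxE eqxx /= => /eqP; rewrite oppr_eq0 gt_eqF.
have := potential_sconvex phi_sconvex pS (psd_conj U pS) SU p01.
rewrite (potential_unitary phi uU hS) -mulrDl.
have -> : 1 - p + (1 - (1 - p)) = 1 by ring.
by rewrite mul1r.
Qed.

(** Exchanging the two eigenvectors of S spanned by X is a unitary conjugation. *)
Lemma potential_swap (S : 'M[C]_d) (X : 'M[C]_(d, 2)) (c1 c2 : R) :
  psd S -> X^t* *m X = 1%:M -> S *m X = X *m rmx c1 0 0 c2 ->
  let S' := S + (c1 - c2)%:C *: (X *m rmx (-1) 0 0 1 *m X^t*) in
  psd S' /\ potential S' = potential S.
Proof.
move=> pS XX SX S'; have [hS _] := pS.
pose w : 'M[C]_2 := rmx 0 1 1 0.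
have wt : w^t* = w by rewrite rmx_ct.
have uw : w \is unitarymx.
  by apply/unitarymxP; rewrite wt rmxM rmx1; congr rmx; ring.
set D := rmx c1 0 0 c2 in SX.
have hD : D^t* = D by rewrite rmx_ct.
have eU := plane_conj w XX hS hD SX.
have uU := plane_unitary XX uw.
set U := 1%:M + _ in uU eU.
suff -> : S' = U *m S *m U^t*.
  by split; [exact: psd_conj | rewrite (potential_unitary phi uU hS)].
have eK : w *m D *m w^t* - D = (c1 - c2)%:C *: rmx (-1) 0 0 1.
  by rewrite wt !rmxM rmxB rmxZ; congr rmx; ring.
by rewrite eU /S' eK -scalemxAr -scalemxAl.
Qed.

(** Sublevel sets of the potential are convex.  The total weight is kept below 1
    so that what is left of it, after one A t has been split off, can serve as a
    divisor. *)
Lemma potential_hull k (S : 'M[C]_d) (A : 'I_k -> 'M[C]_d) (w : 'I_k -> R) :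
  psd S -> (forall t, psd (A t)) -> (forall t, potential (A t) <= potential S) ->
  (forall t, 0 <= w t) -> \sum_t w t < 1 ->
  let S' := S + \sum_t (w t)%:C *: (A t - S) in
  psd S' /\ potential S' <= potential S.
Proof.
move=> pS; elim: k A w => [|k IH] A w pA ltA w0 w1 S'.
  by rewrite /S' big_ord0 addr0.
have rest0 : 0 <= \sum_t w (lift ord0 t) by apply: sumr_ge0 => t _; exact: w0.
move: w1; rewrite big_ord_recl; set v := w ord0 => w1.
have v0 : 0 <= v by exact: w0.
have u0 : 0 < 1 - v by lra.
have w0' t : 0 <= w (lift ord0 t) / (1 - v) by rewrite divr_ge0 // ltW.
have w1' : \sum_t w (lift ord0 t) / (1 - v) < 1.
  by rewrite -mulr_suml ltr_pdivrMr //; lra.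
have [pX ltX] := IH _ _ (fun t => pA (lift ord0 t)) (fun t => ltA (lift ord0 t)) w0' w1'.
move: pX ltX; set X := S + _ => pX ltX.
have -> : S' = v%:C *: A ord0 + (1 - v)%:C *: X.
  rewrite /S' /X big_ord_recl -/v [(1 - v)%:C *: (S + _)]scalerDr.
  rewrite [(1 - v)%:C *: \sum__ _]scaler_sumr.
  rewrite [in RHS](eq_bigr (fun t => (w (lift ord0 t))%:C *: (A (lift ord0 t) - S))).
    rewrite addrA addrA; congr (_ + _).
    by apply/matrixP => i j; rewrite !mxE rmorphB /=; ring.
  move=> t _; rewrite scalerA -rmorphM /=; congr ((_)%:C *: _).
  by field; rewrite gt_eqF.
split; first exact: (psdD (psdZ v0 (pA ord0)) (psdZ (ltW u0) pX)).
have [->|AX] := eqVneq (A ord0) X.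
  by rewrite -scalerDl -rmorphD /= addrC subrK scale1r.
have [v00|vn0] := eqVneq v 0; first by rewrite v00 scale0r add0r subr0 scale1r.
have v01 : 0 < v < 1 by rewrite lt_def vn0 v0; lra.
apply: (le_trans (ltW (potential_sconvex phi_sconvex (pA ord0) pX AX v01))).
have := ltA ord0; move: ltX; clear -v0 u0.
move: (potential X) (potential (A ord0)) (potential S) => x a s; nra.
Qed.

(** Total weight below 1/2 leaves room to double the displacement within the
    convex hull; the matrix in the statement is the midpoint, where strict
    convexity applies. *)
Lemma potential_hull_lt k (S : 'M[C]_d) (A : 'I_k -> 'M[C]_d) (w : 'I_k -> R) :
  psd S -> (forall t, psd (A t)) -> (forall t, potential (A t) <= potential S) ->
  (forall t, 0 <= w t) -> \sum_t w t < 1 / 2 ->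
  \sum_t (w t)%:C *: (A t - S) != 0 ->
  potential (S + \sum_t (w t)%:C *: (A t - S)) < potential S.
Proof.
move=> pS pA ltA w0 w1 n0.
have [|/=|pX ltX] := potential_hull (w := fun t => 2 * w t) pS pA ltA.
- by move=> t; rewrite mulr_ge0.
- by rewrite -mulr_sumr; lra.
move: n0 pX ltX; set Z := \sum_t _ => n0.
have -> : \sum_t (2 * w t)%:C *: (A t - S) = 2 *: Z.
  by rewrite /Z scaler_sumr; apply: eq_bigr => t _; rewrite scalerA rmorphM /= rmorph_nat.
move: Z n0 => Z n0 pX ltX.
have h : 0 < (1 / 2 : R) < 1 by lra.
have SX : S != S + 2 *: Z.
  by rewrite -subr_eq0 opprD addrA subrr add0r oppr_eq0 scaler_eq0 negb_or n0 pnatr_eq0.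
have := potential_sconvex phi_sconvex pS pX SX h.
have -> : (1 / 2)%:C *: S + (1 - 1 / 2)%:C *: (S + 2 *: Z) = S + Z.
  have -> : 1 - 1 / 2 = 1 / 2 :> R by field.
  rewrite scalerDr scalerA addrA -scalerDl -rmorphD /=.
  have -> : 1 / 2 + 1 / 2 = 1 :> R by field.
  by rewrite scale1r -(rmorph_nat (real_complex R)) -rmorphM /= mul1r mulVf ?pnatr_eq0 // scale1r.
move=> /lt_le_trans; apply; move: ltX.
by move: (potential _) (potential S) => x s; lra.
Qed.

(** Subtract the lowest eigenvalue g i0 from the diagonal matrix and let L be the
    square root of the rest, so that L e = 0 for the i0-th basis vector e.  Then
    diagC g + z z^* = g i0 + M M^* with M = L + z e^*, which has the same
    spectrum as N = g i0 + M^* M.  In N, the vector z occurs through its norm and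
    through the row and column of index i0 off the diagonal, where its i0-th
    entry is killed by L.  Shrinking the other entries of z by s at constant norm
    thus shrinks these off-diagonal entries of N by s, and the result is an
    average of N and of its conjugate by the sign change of e. *)
Lemma potential_rank_one (g : 'I_d -> R) (i0 k : 'I_d) (z z' : 'cV[C]_d) (s : R) :
  0 <= g i0 -> (forall j, g i0 <= g j) -> 0 <= s < 1 ->
  (forall j, j != i0 -> z' j 0 = s%:C * z j 0) ->
  \sum_j nsq (z' j 0) = \sum_j nsq (z j 0) ->
  z k 0 != 0 -> g i0 < g k ->
  potential (diagC g + z' *m z'^t*) < potential (diagC g + z *m z^t*).
Proof.
move=> g0 gmin s01 z'E nz' zk gk.
pose L j : R := Num.sqrt (g j - g i0).
have L2 j : L j ^+ 2 = g j - g i0 by rewrite sqr_sqrtr // subr_ge0.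
pose e : 'rV[C]_d := delta_mx 0 i0.
have ee : e *m e^t* = 1%:M.
  rewrite trmx_delta map_delta_mx mul_delta_mx.
  by apply/matrixP => i j; rewrite !ord1 !mxE !eqxx.
have eL : e *m diagC L = 0.
  apply/rowP => j; rewrite mul_mx_diag !mxE /L.
  case: (altP (j =P i0)) => [->|_]; last by rewrite mul0r.
  by rewrite subrr sqrtr0 mulr0.
have LL : diagC L *m diagC L = diagC (fun j => g j - g i0).
  apply/matrixP => i j; rewrite mul_diag_mx mxE !diagCE mxE.
  by case: eqP => [->|_]; rewrite ?mulr0n ?mulr0 // !mulr1n -rmorphM -expr2 L2.
pose M (u : 'cV[C]_d) := diagC L + u *m e.
have Mt u : (M u)^t* = diagC L + e^t* *m u^t* by rewrite ctmxD ctmx_diagC ctmx_mul.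
have Le : diagC L *m e^t* = 0.
  by rewrite -[diagC L]ctmx_diagC -ctmx_mul eL trmx0 map_mx0.
have gE u : diagC g + u *m u^t* = (g i0)%:C%:M + M u *m (M u)^t*.
  rewrite Mt /M mulmxDl !mulmxDr LL.
  rewrite [diagC L *m _]mulmxA Le mul0mx addr0 -[u *m e *m diagC L]mulmxA eL mulmx0 add0r.
  rewrite -mulmxA (mulmxA e) ee mul1mx addrA; congr (_ + _).
  apply/matrixP => i j; rewrite [RHS]mxE [in RHS]mxE !diagCE.
  by case: (i == j); rewrite ?mulr1n ?mulr0n ?addr0 // rmorphB /= addrC subrK.
pose N (u : 'cV[C]_d) := (g i0)%:C%:M + (M u)^t* *m M u.
have potN u : potential (diagC g + u *m u^t*) = potential (N u).
  exact: (etrans (congr1 _ (gE u)) (potential_gramC phi (M u) (g i0))).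
have NE u j m : N u j m = (g i0)%:C *+ (j == m) + ((L j ^+ 2)%:C *+ (j == m)
    + (m == i0)%:R * ((L j)%:C * u j 0)
    + (j == i0)%:R * ((L m)%:C * (u m 0)^*)
    + (j == i0)%:R * (m == i0)%:R * (\sum_r nsq (u r 0))%:C).
  rewrite /N Mt mxE [X in X + _]mxE; congr (_ + _).
  rewrite /M mulmxDl !mulmxDr LL mulmxA -[e^t* *m u^t* *m (u *m e)]mulmxA.
  rewrite -[e^t* *m u^t* *m diagC L]mulmxA (mulmxA (u^t*) u).
  rewrite [u^t* *m u]mx11_scalar mul_scalar_mx -scalemxAr.
  have -> : (u^t* *m u) 0 0 = (\sum_r nsq (u r 0))%:C.
    rewrite mxE rmorph_sum; apply: eq_bigr => r _ /=.
    by rewrite ctmxE nsqE mulrC.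
  have eE m' : e 0 m' = (m' == i0)%:R by rewrite mxE eqxx.
  rewrite !mxE !big_ord1 !ctmxE !eE mul_diag_mx mul_mx_diag !mxE L2.
  by rewrite rmorph_nat !addrA; congr (_ + _ + _ + _); ring.
pose sg (j : 'I_d) : R := if j == i0 then -1 else 1.
have uD : diagC sg \is unitarymx.
  apply/unitarymxP; rewrite ctmx_diagC; apply/matrixP => i j.
  rewrite mul_diag_mx mxE diagCE !mxE.
  case: (i == j); last by rewrite !mulr0n mulr0.
  by rewrite !mulr1n -rmorphM /sg; case: ifP; rewrite ?mulrNN mulr1.
have pN u : psd (N u).
  apply: psdD; last by have := psd_gram ((M u)^t*); rewrite trmxCK.
  have -> : (g i0)%:C%:M = diagC (fun=> g i0) :> 'M[C]_d.
    by apply/matrixP => i j; rewrite diagCE mxE.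
  exact: psd_diagC.
have DN u j m : (diagC sg *m N u *m (diagC sg)^t*) j m = (sg j * sg m)%:C * N u j m.
  rewrite ctmx_diagC mul_mx_diag mxE mul_diag_mx mxE.
  by move: (N u j m) => x; rewrite !mxE rmorphM /=; ring.
have p01 : 0 < (1 + s) / 2 < 1 by lra.
have eN : N z' = ((1 + s) / 2)%:C *: N z
    + (1 - (1 + s) / 2)%:C *: (diagC sg *m N z *m (diagC sg)^t*).
  apply/matrixP => j m; rewrite [RHS]mxE [X in X + _]mxE [X in _ + X]mxE DN.
  rewrite mulrA -rmorphM -mulrDl -rmorphD /=.
  have -> : (1 + s) / 2 + (1 - (1 + s) / 2) * (sg j * sg m) =
     if (j == i0) == (m == i0) then 1 else s.
    by rewrite /sg; case: (j == i0); case: (m == i0) => /=; field.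
  have L0 : L i0 = 0 by rewrite /L subrr sqrtr0.
  rewrite !NE nz'; case: (altP (j =P i0)) => [->|ji]; case: (altP (m =P i0)) => [->|mi] /=.
  - by rewrite !eqxx !L0 expr0n /= !rmorph0 !mul0r !mulr0 rmorph1 !mul1r.
  - by rewrite eq_sym (negPf mi) (z'E m mi) conjCZ !mulr0n /=; ring.
  - by rewrite (negPf ji) (z'E j ji) !mulr0n /=; ring.
  - by rewrite !mul0r rmorph1 mul1r.
rewrite !potN eN.
have ND : N z != diagC sg *m N z *m (diagC sg)^t*.
  apply/eqP => /matrixP/(_ k i0); rewrite DN.
  have ki : k != i0 by apply: contraTneq gk => ->; rewrite ltxx.
  rewrite /sg eqxx (negPf ki) mul1r NE (negPf ki) eqxx !mulr0n !mul0r !addr0 !add0r mul1r.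
  move=> /eqP; rewrite rmorphN1 mulN1r -subr_eq0 opprK -mulr2n mulrn_eq0 /= mulf_eq0.
  rewrite (negPf zk) orbF -[0]/(0%:C) (inj_eq (@complexI R)) sqrtr_eq0.
  by rewrite subr_le0 leNgt gk.
have := potential_sconvex phi_sconvex (pN z) (psd_conj (diagC sg) (pN z)) ND p01.
rewrite (potential_unitary phi uD (pN z).1) -mulrDl.
have -> : (1 + s) / 2 + (1 - (1 + s) / 2) = 1 by ring.
by rewrite mul1r.
Qed.

End Descent.

(** * Local minimizers consist of eigenvectors *)

Section Eps.
Variable R : realType.
(** The finitely many smallness conditions of a perturbation are added up into a
    single K. *)
Lemma small_parameter (K : R) : 0 <= K ->
  exists eps : R, [/\ 0 < eps, eps <= 1 / 4 & eps ^+ 2 * K < 1].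
Proof.
move=> K0; exists (4 + K)^-1; have K4 : 0 < 4 + K by lra.
split; first by rewrite invr_gt0.
  by rewrite mul1r lef_pV2 // ?posrE //; lra.
by rewrite exprVn mulrC ltr_pdivrMr ?exprn_gt0 // mul1r; nra.
Qed.

Lemma extend_modulus (z : R[i]) (delta : R) : 0 <= delta ->
  exists2 z', nsq z' = nsq z + delta & nsq (z' - z) <= delta.
Proof.
move=> d0; have [->|z0] := eqVneq z 0.
  exists (Num.sqrt delta)%:C; first by rewrite nsqR sqr_sqrtr // /nsq /= expr0n /= !add0r.
  by rewrite subr0 nsqR sqr_sqrtr.
have n0 : 0 < nsq z by rewrite lt_def nsq_eq0 z0 nsq_ge0.
pose r := Num.sqrt (1 + delta / nsq z).
have x0 : 0 <= delta / nsq z by rewrite divr_ge0 // ltW.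
have r2 : r ^+ 2 = 1 + delta / nsq z by rewrite sqr_sqrtr //; lra.
have r1 : 1 <= r by rewrite -sqrtr1 ler_wsqrtr //; lra.
exists (r%:C * z).
  by rewrite nsqM nsqR r2 mulrDl mul1r divfK // gt_eqF.
have -> : r%:C * z - z = (r - 1)%:C * z by rewrite rmorphB /= mulrBl mul1r.
rewrite nsqM nsqR -ler_pdivlMr //; nra.
Qed.
End Eps.

Section LocalMin.
Variables (R : realType) (d k : nat).
Local Notation C := R[i].
Variable phi : R -> R.
Hypothesis phi_sconvex : strictly_convex_nonneg phi.
Local Notation potential := (@potential R d phi).
Implicit Types (G : 'M[C]_(d, k)) (S : 'M[C]_d).

Definition colnsq G (t : 'I_k) : R := \sum_j nsq (G j t).

(** The columns of G form the sequence of vectors; the competitors have the same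
    column norms, so the list of prescribed norms need not be mentioned. *)
Definition localmin S G := exists2 e : R, 0 < e & forall G',
  (forall t, colnsq G' t = colnsq G t) -> (forall t, colnsq (G' - G) t < e) ->
  potential (S + G *m G^t*) <= potential (S + G' *m G'^t*).

Lemma colnsq_ge0 G t : 0 <= colnsq G t.
Proof. by apply: sumr_ge0 => j _; rewrite nsq_ge0. Qed.

Lemma nsq_le_colnsq G j t : nsq (G j t) <= colnsq G t.
Proof.
by rewrite /colnsq (bigD1 j) //= lerDl sumr_ge0 // => i _; rewrite nsq_ge0.
Qed.

Lemma colnsqE G t : (colnsq G t)%:C = (G^t* *m G) t t.
Proof.
rewrite mxE rmorph_sum; apply: eq_bigr => j _ /=.
by rewrite ctmxE nsqE mulrC.
Qed.

Lemma colnsq_unitary (U : 'M[C]_d) G t : U \is unitarymx ->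
  colnsq (U *m G) t = colnsq G t.
Proof.
move=> uU; apply: complexI; rewrite !colnsqE ctmx_mul -mulmxA (mulmxA (U^t*)).
by rewrite unitary_mulVmx // mul1mx.
Qed.

Lemma gramE G i j : (G *m G^t*) i j = \sum_t G i t * (G j t)^*.
Proof. by rewrite mxE; apply: eq_bigr => t _; rewrite ctmxE. Qed.

Lemma potential_unitary_gram (U : 'M[C]_d) S G : U \is unitarymx -> psd S ->
  potential (U *m S *m U^t* + (U *m G) *m (U *m G)^t*) = potential (S + G *m G^t*).
Proof.
move=> uU pS.
have <- : U *m (S + G *m G^t*) *m U^t* = U *m S *m U^t* + U *m G *m (U *m G)^t*.
  by rewrite mulmxDr mulmxDl ctmx_mul !mulmxA.
exact: (potential_unitary phi uU (psdD pS (psd_gram G)).1).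
Qed.

Lemma localmin_unitary (U : 'M[C]_d) S G : U \is unitarymx -> psd S ->
  localmin S G -> localmin (U *m S *m U^t*) (U *m G).
Proof.
move=> uU pS [e e0 min]; exists e; first exact: e0.
move=> G' nG' dG'.
have eG' : G' = U *m (U^t* *m G') by rewrite mulmxA unitary_mulmxV // mul1mx.
rewrite eG' !(potential_unitary_gram _ uU pS); apply: min => t.
  by rewrite (colnsq_unitary _ _ (unitary_ctmx uU)) nG' colnsq_unitary.
have -> : U^t* *m G' - G = U^t* *m (G' - U *m G).
  by rewrite mulmxBr (mulmxA _ U) unitary_mulVmx // mul1mx.
by rewrite (colnsq_unitary _ _ (unitary_ctmx uU)).
Qed.

(** In an eigenbasis of S + G G^* - g_t g_t^*, the column g_t is supported on the
    lowest eigenvalue: otherwise shrink its other entries by a factor s close to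
    1, give the lost mass to a lowest entry and apply [potential_rank_one]. *)
Lemma localmin_bottom_diag S G t (g : 'I_d -> R) : psd S -> localmin S G ->
  (forall j, 0 <= g j) ->
  S + G *m G^t* - col t G *m (col t G)^t* = diagC g ->
  forall j, G j t != 0 -> forall i, g j <= g i.
Proof.
move=> pS [e e0 min] g0 eg j Gj.
pose i0 := [arg min_(i < j) g i]%O.
have gi0 i : g i0 <= g i by rewrite /i0; case: arg_minP => // m _; apply.
suff: g j <= g i0 by move=> /le_trans le i; exact/le.
rewrite leNgt; apply/negP => gj.
pose X := colnsq G t; have X0 : 0 <= X := colnsq_ge0 G t.
(* The squared distance to the new column is at most 2 * (1 - s) * X. *)
pose s := 1 - e / (e + 4 * (X + 1)).
have den : 0 < e + 4 * (X + 1) by lra.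
have s1 : 1 - s = e / (e + 4 * (X + 1)) by rewrite /s; ring.
have s01 : 0 <= s < 1.
  rewrite -subr_gt0 s1 divr_gt0 // andbT /s subr_ge0 ler_pdivrMr //; lra.
move: s s1 s01 => s s1 s01.
pose Y := \sum_(i | i != i0) nsq (G i t).
have Y0 : 0 <= Y by apply: sumr_ge0 => i _; rewrite nsq_ge0.
have XY : X = nsq (G i0 t) + Y by rewrite /X /colnsq (bigD1 i0).
have YX : Y <= X by rewrite XY lerDr nsq_ge0.
have [|y ny dy] := @extend_modulus R (G i0 t) ((1 - s ^+ 2) * Y).
  by rewrite mulr_ge0 //; nra.
pose z : 'cV[C]_d := col t G.
pose z' : 'cV[C]_d := \col_i if i == i0 then y else s%:C * G i t.
have z'i i : i != i0 -> z' i 0 = s%:C * z i 0 by move=> ii0; rewrite !mxE (negPf ii0).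
have nz' : \sum_i nsq (z' i 0) = \sum_i nsq (z i 0).
  rewrite (bigD1 i0) //= [RHS](bigD1 i0) //= mxE eqxx ny !mxE.
  have -> : \sum_(i | i != i0) nsq (z' i 0) = s ^+ 2 * Y.
    by rewrite /Y mulr_sumr; apply: eq_bigr => i ii0; rewrite z'i // nsqM nsqR mxE.
  have -> : \sum_(i | i != i0) nsq (z i 0) = Y by apply: eq_bigr => i _; rewrite mxE.
  by ring.
pose G' : 'M[C]_(d, k) := \matrix_(i, u) if u == t then z' i 0 else G i u.
have sumz : \sum_i nsq (z i 0) = X by apply: eq_bigr => i _; rewrite mxE.
have nG' u : colnsq G' u = colnsq G u.
  have [->|ut] := eqVneq u t; last first.
    by apply: eq_bigr => i _; rewrite mxE (negPf ut).
  by rewrite -/X -sumz -nz'; apply: eq_bigr => i _; rewrite mxE eqxx.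
have dG' u : colnsq (G' - G) u < e.
  have [->|ut] := eqVneq u t; last first.
    rewrite /colnsq big1 // => i _; rewrite !mxE (negPf ut) subrr.
    by apply/eqP; rewrite nsq_eq0.
  rewrite /colnsq (bigD1 i0) //=.
  have -> : nsq ((G' - G) i0 t) = nsq (y - G i0 t) by rewrite !mxE !eqxx.
  have -> : \sum_(i | i != i0) nsq ((G' - G) i t) = (1 - s) ^+ 2 * Y.
    rewrite /Y mulr_sumr; apply: eq_bigr => i ii0.
    rewrite !mxE eqxx (negPf ii0).
    have -> : s%:C * G i t - G i t = (s - 1)%:C * G i t by rewrite rmorphB /= mulrBl mul1r.
    by rewrite nsqM nsqR; congr (_ * _); ring.
  have : (1 - s ^+ 2) * Y + (1 - s) ^+ 2 * Y < e.
    have -> : (1 - s ^+ 2) * Y + (1 - s) ^+ 2 * Y = 2 * (1 - s) * Y by ring.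
    rewrite s1; have -> : 2 * (e / (e + 4 * (X + 1))) * Y = e * (2 * Y) / (e + 4 * (X + 1)).
      by field; rewrite gt_eqF.
    by rewrite ltr_pdivrMr // ltr_pM2l //; lra.
  by move: dy; move: (nsq _) => q; lra.
have gram (H : 'M[C]_(d, k)) :
    H *m H^t* = col t H *m (col t H)^t* + \matrix_(i, m) \sum_(u | u != t) H i u * (H m u)^*.
  apply/matrixP => i m; rewrite gramE mxE (bigD1 t) //=; congr (_ + _).
    by rewrite mxE big_ord1 ctmxE !mxE.
  by rewrite mxE.
have colG' : col t G' = z' by apply/colP => i; rewrite !mxE eqxx.
have rest : \matrix_(i, m) \sum_(u | u != t) G' i u * (G' m u)^* =
    \matrix_(i, m) \sum_(u | u != t) G i u * (G m u)^*.
  apply/matrixP => i m; rewrite !mxE; apply: eq_bigr => u ut.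
  by rewrite !mxE (negPf ut).
have eS : S + G *m G^t* = diagC g + z *m z^t* by rewrite -eg subrK.
have eS' : S + G' *m G'^t* = diagC g + z' *m z'^t*.
  rewrite (gram G') colG' rest -eg (gram G).
  move: (\matrix_(i, m) _) (col t G *m _) (z' *m _) => M1 M2 M3.
  by apply/matrixP => i m; rewrite !mxE; ring.
have zj : z j 0 != 0 by rewrite mxE.
have := potential_rank_one phi_sconvex (g0 i0) gi0 s01 z'i nz' zj gj.
by rewrite -eS -eS' ltNge min.
Qed.

Lemma psd_sum_cols S G t : psd S -> psd (S + G *m G^t* - col t G *m (col t G)^t*).
Proof.
move=> pS; pose H : 'M[C]_(d, k) := \matrix_(i, u) if u == t then 0 else G i u.
suff -> : S + G *m G^t* - col t G *m (col t G)^t* = S + H *m H^t*.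
  exact: (psdD pS (psd_gram H)).
rewrite -addrA; congr (_ + _); apply/matrixP => i m.
rewrite mxE [X in _ + X]mxE !gramE (bigD1 t) //= [RHS](bigD1 t) //=.
rewrite [X in _ - X]mxE big_ord1 ctmxE !mxE eqxx mul0r add0r addrAC subrr add0r.
by apply: eq_bigr => u ut; rewrite !mxE (negPf ut).
Qed.

(** By [localmin_bottom_diag], g_t is an eigenvector of S + G G^* - g_t g_t^*,
    hence also of S + G G^*. *)
Lemma localmin_eigen S G t : psd S -> localmin S G ->
  exists c : R, (S + G *m G^t*) *m col t G = c%:C *: col t G.
Proof.
move=> pS min; have pT := psd_sum_cols G t pS.
have [P [g [uP eT]]] := hermitian_spectral pT.1.
have g0 j : 0 <= g j by apply: (psd_eig_ge0 uP); rewrite -eT.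
have colP_ : col t (P *m G) = P *m col t G by rewrite !colE mulmxA.
have bot := localmin_bottom_diag (psd_conj P pS) (localmin_unitary uP pS min) g0 (t := t).
have {}bot j : (P *m G) j t != 0 -> forall i, g j <= g i.
  apply: bot; rewrite colP_ !ctmx_mul -(unitary_conjVK (diagC g) uP) -eT.
  rewrite mulmxBr mulmxDr mulmxBl mulmxDl !mulmxA.
  by [].
have [i|noj] := pickP (fun j => (P *m G) j t != 0); last first.
  exists 0; have -> : col t G = 0; last by rewrite mulmx0 scaler0.
  rewrite -[col t G]mul1mx -(unitary_mulVmx uP) -mulmxA -colP_.
  suff -> : col t (P *m G) = 0 by rewrite mulmx0.
  apply/colP => j; rewrite [col _ _ _ _]mxE [RHS]mxE.
  by have /negbFE/eqP := noj j.
move=> Gi; exists (g i + colnsq G t).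
have -> : S + G *m G^t* = P^t* *m diagC g *m P + col t G *m (col t G)^t*.
  by rewrite -eT subrK.
have -> : (g i + colnsq G t)%:C = (g i)%:C + (colnsq G t)%:C by rewrite rmorphD.
rewrite mulmxDl scalerDl; congr (_ + _); last first.
  rewrite -mulmxA [(col t G)^t* *m _]mx11_scalar mul_mx_scalar colnsqE.
  by congr (_ *: _); rewrite !mxE; apply: eq_bigr => j _; rewrite !mxE.
have -> : P^t* *m diagC g *m P *m col t G = P^t* *m (diagC g *m (P *m col t G)).
  by rewrite !mulmxA.
have -> : diagC g *m (P *m col t G) = (g i)%:C *: (P *m col t G).
  rewrite -colP_; apply/colP => j; rewrite mul_diag_mx [LHS]mxE [RHS]mxE [col _ _ _ _]mxE mxE.
  have [->|Gj] := eqVneq ((P *m G) j t) 0; first by rewrite !mulr0.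
  by congr (_%:C * _); apply/eqP; rewrite eq_le !bot.
by rewrite -scalemxAr mulmxA (unitary_mulVmx uP) mul1mx.
Qed.

End LocalMin.

(** * Order of the eigenvalues at a local minimizer *)

Section Diagonal.
Variables (R : realType) (d k : nat).
Local Notation C := R[i].
Variable phi : R -> R.
Hypothesis phi_sconvex : strictly_convex_nonneg phi.
Local Notation potential := (@potential R d phi).

Definition coord_frame (i l : 'I_d) : 'M[C]_(d, 2) :=
  \matrix_(j, b) (j == (if b == 0 then i else l))%:R.

Lemma coord_frame_mul n i l (Y : 'M[C]_(2, n)) j t :
  (coord_frame i l *m Y) j t = (j == i)%:R * Y 0 t + (j == l)%:R * Y 1 t.
Proof.
rewrite mxE !big_ord_recl big_ord0 addr0 !mxE /=.
by congr (_ + _ * Y _ _); apply: val_inj.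
Qed.

Lemma coord_frame_ct_mul n i l (Y : 'M[C]_(d, n)) b t :
  ((coord_frame i l)^t* *m Y) b t = Y (if b == 0 then i else l) t.
Proof.
rewrite mxE (bigD1 (if b == 0 then i else l)) //= big1 => [|j jb].
  by rewrite ctmxE mxE eqxx conjC1 mul1r addr0.
by rewrite ctmxE mxE (negPf jb) conjC0 mul0r.
Qed.

Lemma coord_frame_unit i l : i != l -> (coord_frame i l)^t* *m coord_frame i l = 1%:M.
Proof.
move=> il; apply/matrixP => b c; rewrite coord_frame_ct_mul !mxE.
case: b => -[|[|//]] ?; case: c => -[|[|//]] ? /=; rewrite ?eqxx //.
  by rewrite (negPf il).
by rewrite eq_sym (negPf il).
Qed.

Lemma diagC_coord_frame i l (nu : 'I_d -> R) :
  diagC nu *m coord_frame i l = coord_frame i l *m rmx (nu i) 0 0 (nu l).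
Proof.
apply/matrixP => j b; rewrite mul_diag_mx coord_frame_mul !mxE /=.
case: b => -[|[|//]] ? /=; rewrite !mulr0 ?addr0 ?add0r.
  by case: eqP => [->|_]; rewrite ?mulr1 ?mul1r ?mulr0 ?mul0r.
by case: eqP => [->|_]; rewrite ?mulr1 ?mul1r ?mulr0 ?mul0r.
Qed.

Variables (S : 'M[C]_d) (G : 'M[C]_(d, k)) (nu mu : 'I_d -> R).
Hypothesis (pS : psd S) (minG : localmin phi S G).
Hypothesis (SGE : S + G *m G^t* = diagC nu) (GGE : G *m G^t* = diagC mu).
Variable c : 'I_k -> R.
Hypothesis eigG : forall t j, G j t != 0 -> nu j = c t.

Lemma gram_diag_ge0 j : 0 <= mu j.
Proof.
have := psd_gram G; rewrite GGE => -[_ /(_ (delta_mx j 0))].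
rewrite -mulmxA -colE mxE (bigD1 j) //= big1 => [|i ij].
  by rewrite ctmxE [col _ _ _ _]mxE diagCE !mxE !eqxx conjC1 mul1r addr0 ler0c.
by rewrite ctmxE mxE (negPf ij) conjC0 mul0r.
Qed.

(** Rotate the i-th basis vector towards the l-th by a small angle and the l-th
    back towards the i-th by another one, and apply this linear map to all
    columns of G.  The map is not unitary, but it keeps the norms of the columns:
    their entries i and l never are both nonzero, because nu i and nu l differ.
    It changes the block of S + G G^* on the two vectors by the matrix with rows
    (- tau, o) and (o, tau); when al i > al l, for al = nu - mu, the angles can
    be chosen such that [potential_two_level] applies. *)
Lemma localmin_opposite i l : 0 < mu i -> nu l < nu i -> nu i - mu i <= nu l - mu l.
Proof.
move=> mui nuli; rewrite leNgt; apply/negP => lt.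
have [e e0 min] := minG.
have mul0 := gram_diag_ge0 l.
have il : i != l by apply: contraTneq nuli => ->; rewrite ltxx.
(* The two angles are about eps and u * eps.  To second order in eps one gains
   tau * Delta - o ^+ 2 = eps ^+ 2 * ((mu i - mu l * u ^+ 2) * Delta
                                       - (mu i - mu l * u) ^+ 2),
   and this choice of u maximizes the gain, with maximum kappa * eps ^+ 2. *)
pose Delta := nu i - nu l; pose W := Delta + mu l; pose u := mu i / W.
have Delta0 : 0 < Delta by rewrite subr_gt0.
have W0 : 0 < W by rewrite /W; lra.
have uW : u * W = mu i by rewrite divfK ?gt_eqF.
have WD : mu i < W by rewrite /W /Delta; lra.
have u0 : 0 < u by rewrite divr_gt0.
have u1 : u < 1 by rewrite ltr_pdivrMr // mul1r.
pose kappa := u * Delta * (W - mu i).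
have kappa0 : 0 < kappa by apply: mulr_gt0; [exact: mulr_gt0 | rewrite subr_gt0].
pose K1 := 4 * (\sum_t colnsq G t) / e.
pose K2 := (4 * Delta * mu l + 4 * mu i ^+ 2) / kappa.
have sum0 : 0 <= \sum_t colnsq G t by apply: sumr_ge0 => t _; exact: colnsq_ge0.
have K10 : 0 <= K1 by rewrite divr_ge0 // ?(ltW e0) // mulr_ge0.
have num0 : 0 <= 4 * Delta * mu l + 4 * mu i ^+ 2.
  by rewrite addr_ge0 // ?mulr_ge0 ?sqr_ge0 // ltW.
have K20 : 0 <= K2 by rewrite divr_ge0 // ltW.
have [eps [eps0 eps4 epsK]] := small_parameter (addr_ge0 K10 K20).
have epsK1 : eps ^+ 2 * K1 < 1.
  by apply: le_lt_trans epsK; rewrite ler_wpM2l ?sqr_ge0 // lerDl.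
have epsK2 : eps ^+ 2 * K2 < 1.
  by apply: le_lt_trans epsK; rewrite ler_wpM2l ?sqr_ge0 // lerDr.
have h1 : 0 <= eps <= 1 / 4 by rewrite (ltW eps0).
have h2 : 0 <= u * eps <= 1 / 4.
  rewrite mulr_ge0 ?(ltW u0) ?(ltW eps0) //=; apply: le_trans eps4.
  by rewrite -[leRHS]mul1r ler_pM2r // ltW.
have [[Ca sa] /= [[Ca0 sa0 Ca1 Casa /andP[lea gea]] [dCa _]]] := small_rotation h1.
have [[Cb sb] /= [[Cb0 sb0 Cb1 Cbsb /andP[leb geb]] [dCb _]]] := small_rotation h2.
pose w := rmx Ca (- sb) sa Cb : 'M[C]_2.
pose X := coord_frame i l.
have XX : X^t* *m X = 1%:M by exact: coord_frame_unit.
pose U := 1%:M + X *m (w - 1%:M) *m X^t*.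
pose G' := U *m G.
have UGE j t : G' j t = if j == i then Ca%:C * G i t - sb%:C * G l t
   else if j == l then sa%:C * G i t + Cb%:C * G l t else G j t.
  rewrite /G' /U mulmxDl mul1mx mxE -mulmxA -(mulmxA X) coord_frame_mul.
  set Y := X^t* *m G.
  have Y0 : Y 0 t = G i t by exact: coord_frame_ct_mul.
  have Y1 : Y 1 t = G l t by exact: coord_frame_ct_mul.
  have sub1E (v : 'M[C]_2) b b' : (v - 1%:M) b b' = v b b' - (b == b')%:R by rewrite !mxE.
  have YE b : ((w - 1%:M) *m Y) b t = (w b 0 - (b == 0)%:R) * G i t + (w b 1 - (b == 1)%:R) * G l t.
    rewrite mxE !big_ord_recl big_ord0 addr0.
    have -> : lift ord0 ord0 = 1 :> 'I_2 by exact: val_inj.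
    by rewrite Y0 Y1 !sub1E.
  rewrite !YE !mxE /= !rmorphN /=.
  case: (altP (j =P i)) => [->|ji].
    by rewrite (negPf il) /=; ring.
  case: (altP (j =P l)) => [->|jl] /=; first by ring.
  by rewrite /=; ring.
have GiGl t : G i t = 0 \/ G l t = 0.
  have [->|Gi] := eqVneq (G i t) 0; first by left.
  have [->|Gl] := eqVneq (G l t) 0; first by right.
  by move: nuli; rewrite (eigG Gi) (eigG Gl) ltxx.
have split2 (H : 'M[C]_(d, k)) t : colnsq H t = nsq (H i t) + nsq (H l t) +
    \sum_(j | (j != i) && (j != l)) nsq (H j t).
  by rewrite /colnsq (bigD1 i) //= (bigD1 l) 1?eq_sym //= addrA.
have nG' t : colnsq G' t = colnsq G t.
  rewrite !split2; congr (_ + _); last first.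
    by apply: eq_bigr => j /andP[ji jl]; rewrite UGE (negPf ji) (negPf jl).
  rewrite !UGE !eqxx [l == i]eq_sym (negPf il).
  case: (GiGl t) => ->; rewrite !mulr0 ?add0r ?addr0 ?subr0.
    rewrite -mulNr -rmorphN !nsqM !nsqR sqrrN -mulrDl [sb ^+ 2 + _]addrC Cb1 mul1r.
    by rewrite expr0n /= add0r.
  rewrite !nsqM !nsqR -mulrDl Ca1 mul1r.
  by rewrite expr0n /= addr0.
have dG' t : colnsq (G' - G) t < e.
  have : colnsq (G' - G) t <= 4 * eps ^+ 2 * colnsq G t.
    have DE j : (G' - G) j t = G' j t - G j t by rewrite mxE [X in _ + X]mxE.
    rewrite split2 [X in _ + X]big1 => [|j /andP[ji jl]]; last first.
      rewrite DE UGE (negPf ji) (negPf jl) subrr.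
      by apply/eqP; rewrite nsq_eq0.
    rewrite addr0.
    rewrite !DE !UGE !eqxx [l == i]eq_sym (negPf il).
    have u2 : u ^+ 2 <= 1 by rewrite expr_le1 ?ltW.
    case: (GiGl t) => ->; rewrite !mulr0 ?add0r ?addr0 ?subr0.
      have -> : Cb%:C * G l t - G l t = (Cb - 1)%:C * G l t by rewrite rmorphB /= mulrBl mul1r.
      rewrite -mulNr -rmorphN !nsqM !nsqR -mulrDl; apply: ler_pM; rewrite ?nsq_ge0 //.
      + by rewrite addr_ge0 // sqr_ge0.
      + have : (u * eps) ^+ 2 <= eps ^+ 2 by rewrite exprMn ler_piMl ?sqr_ge0.
        have -> : (- sb) ^+ 2 + (Cb - 1) ^+ 2 = 2 * (1 - Cb) by rewrite -Cb1; nra.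
        by lra.
      + exact: nsq_le_colnsq.
    have -> : Ca%:C * G i t - G i t = (Ca - 1)%:C * G i t by rewrite rmorphB /= mulrBl mul1r.
    rewrite !nsqM !nsqR -mulrDl; apply: ler_pM; rewrite ?nsq_ge0 //.
    + by rewrite addr_ge0 // sqr_ge0.
    + have -> : (Ca - 1) ^+ 2 + sa ^+ 2 = 2 * (1 - Ca) by rewrite -Ca1; nra.
      by lra.
    + exact: nsq_le_colnsq.
  move=> /le_lt_trans; apply; apply: (@le_lt_trans _ _ (4 * eps ^+ 2 * \sum_t colnsq G t)).
    apply: ler_wpM2l; first by rewrite mulr_ge0 ?sqr_ge0.
    rewrite (bigD1 t) //= lerDl.
    by apply: sumr_ge0 => v _; exact: colnsq_ge0.
  by move: epsK1; rewrite /K1 mulrA ltr_pdivrMr // mul1r mulrA [eps ^+ 2 * 4]mulrC.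
pose tau := mu i * sa ^+ 2 - mu l * sb ^+ 2.
pose o := mu i * eps - mu l * (u * eps).
have eK : w *m rmx (mu i) 0 0 (mu l) *m w^t* - rmx (mu i) 0 0 (mu l) =
    rmx (- tau) o o tau.
  rewrite rmx_ct !rmxM rmxB /tau /o -Cbsb -Casa.
  have m1 := congr1 ( *%R (mu i)) Ca1; have m2 := congr1 ( *%R (mu l)) Cb1.
  by congr rmx; lra.
have eGG' : G' *m G'^t* = diagC mu + X *m rmx (- tau) o o tau *m X^t*.
  rewrite /G' ctmx_mul -(mulmxA U) (mulmxA G) GGE mulmxA.
  rewrite (plane_conj w XX (ctmx_diagC mu) (rmx_ct _ _ _ _) (diagC_coord_frame i l mu)).
  by rewrite eK.
have eS' : S + G' *m G'^t* = diagC nu + X *m rmx (- tau) o o tau *m X^t*.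
  by rewrite eGG' addrA -GGE SGE.
have pSG : psd (diagC nu) by rewrite -SGE; exact: (psdD pS (psd_gram G)).
suff [tau0 small] : 0 < tau /\ tau ^+ 2 + o ^+ 2 < tau * (nu i - nu l).
  have := potential_two_level phi_sconvex pSG XX (diagC_coord_frame i l nu) tau0 small.
  by rewrite -eS' -SGE ltNge (min _ nG' dG').
have {}epsK2 : eps ^+ 2 * (4 * Delta * mu l + 4 * mu i ^+ 2) < kappa.
  by move: epsK2; rewrite /K2 mulrA ltr_pdivrMr // mul1r.
rewrite -/Delta.
have kappaE : (mu i - mu l * u ^+ 2) * Delta - (mu i - mu l * u) ^+ 2 = kappa.
  by rewrite /kappa -uW /W; ring.
have lo : eps ^+ 2 * (mu i - mu l * u ^+ 2) - 4 * mu l * eps ^+ 4 <= tau.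
  have : mu l * sb ^+ 2 <= mu l * ((u * eps) ^+ 2 + 4 * eps ^+ 4).
    rewrite ler_wpM2l //; apply: (le_trans geb); rewrite lerD2l ler_wpM2l //.
    by rewrite exprMn ler_piMl ?exprn_even_ge0 // exprn_ile1 // ltW.
  have : mu i * eps ^+ 2 <= mu i * sa ^+ 2 by rewrite ler_wpM2l // ltW.
  by rewrite /tau exprMn; lra.
have hi : tau <= 2 * mu i * eps ^+ 2.
  have s2 : sa ^+ 2 <= 2 * eps ^+ 2.
    apply: (le_trans gea); have -> : eps ^+ 4 = eps ^+ 2 * eps ^+ 2 by rewrite -exprD.
    have : eps ^+ 2 <= 1 / 16 by nra.
    have := sqr_ge0 eps; move: (eps ^+ 2) => x; nra.
  have : mu i * sa ^+ 2 <= mu i * (2 * eps ^+ 2) by rewrite ler_wpM2l // ltW.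
  have : 0 <= mu l * sb ^+ 2 by rewrite mulr_ge0 ?sqr_ge0.
  by rewrite /tau; lra.
have oE : o ^+ 2 = eps ^+ 2 * (mu i - mu l * u) ^+ 2 by rewrite /o; ring.
have e20 : 0 < eps ^+ 2 by rewrite exprn_gt0.
have e4E : eps ^+ 4 = eps ^+ 2 * eps ^+ 2 by rewrite -exprD.
have loD : eps ^+ 2 * (kappa - 4 * Delta * mu l * eps ^+ 2) + o ^+ 2 <= tau * Delta.
  have := ler_wpM2r (ltW Delta0) lo; rewrite oE -kappaE e4E.
  by move: (eps ^+ 2) => x; lra.
have key : 4 * mu i ^+ 2 * eps ^+ 2 < kappa - 4 * Delta * mu l * eps ^+ 2.
  by move: epsK2; lra.
have tau0 : 0 < tau.
  rewrite -(pmulr_lgt0 _ Delta0); apply: lt_le_trans loD.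
  rewrite ltr_wpDr ?sqr_ge0 // mulr_gt0 //; apply: le_lt_trans key.
  by apply: mulr_ge0; rewrite ?sqr_ge0 // mulr_ge0 ?sqr_ge0.
split=> //; apply: lt_le_trans loD; rewrite ltrD2r.
apply: (@le_lt_trans _ _ (eps ^+ 2 * (4 * mu i ^+ 2 * eps ^+ 2))).
  have -> : eps ^+ 2 * (4 * mu i ^+ 2 * eps ^+ 2) = (2 * mu i * eps ^+ 2) ^+ 2.
    by ring.
  by rewrite lerXn2r // nnegrE // ?(ltW tau0) // !mulr_ge0 ?sqr_ge0 // ltW.
by rewrite ltr_pM2l.
Qed.

End Diagonal.

(** * Linear independence at a local minimizer *)

Section Indep.
Variables (R : realType) (d k : nat).
Local Notation C := R[i].
Variable phi : R -> R.
Hypothesis phi_sconvex : strictly_convex_nonneg phi.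
Local Notation potential := (@potential R d phi).

(** The matrix A is the conjugate of diagC nu by the exchange of the unit vector
    g / sqrt a with the l-th basis vector. *)
Lemma potential_move_mass (nu : 'I_d -> R) (g : 'cV[C]_d) (l : 'I_d) (c a : R) :
  psd (diagC nu) -> 0 < a -> \sum_j nsq (g j 0) = a -> g l 0 = 0 -> nu l < c ->
  (forall j, g j 0 != 0 -> nu j = c) ->
  let A := diagC nu + ((c - nu l) / a)%:C *: (a%:C *: delta_mx l l - g *m g^t*) in
  psd A /\ potential A = potential (diagC nu).
Proof.
move=> pS a0 ga gl lc eg A.
pose r := Num.sqrt a; have r0 : 0 < r by rewrite sqrtr_gt0.
have r2 : r ^+ 2 = a by rewrite sqr_sqrtr // ltW.
pose X : 'M[C]_(d, 2) := \matrix_(j, b) if b == 0 then (r^-1)%:C * g j 0 else (j == l)%:R.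
have XX : X^t* *m X = 1%:M.
  have g2 : \sum_j (g j 0)^* * g j 0 = a%:C.
    by rewrite -ga rmorph_sum; apply: eq_bigr => j _ /=; rewrite nsqE mulrC.
  apply/matrixP => b b'; rewrite mxE.
  case: b => -[|[|//]] ?; case: b' => -[|[|//]] ?; rewrite [RHS]mxE /=.
  - transitivity ((r^-1)%:C * (r^-1)%:C * \sum_j (g j 0)^* * g j 0).
      by rewrite mulr_sumr; apply: eq_bigr => j _; rewrite ctmxE !mxE /= conjCZ; ring.
    rewrite g2 -!rmorphM /= -r2 -[RHS]/(1%:C); congr (_%:C).
    by field; rewrite gt_eqF.
  - rewrite (bigD1 l) //= big1 => [|j jl]; last by rewrite !mxE /= (negPf jl) mulr0.
    by rewrite ctmxE !mxE /= gl mulr0 conjC0 mul0r addr0.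
  - rewrite (bigD1 l) //= big1 => [|j jl]; last first.
      by rewrite ctmxE !mxE /= (negPf jl) conjC0 mul0r.
    by rewrite ctmxE !mxE /= gl !mulr0 addr0.
  - rewrite (bigD1 l) //= big1 => [|j jl]; last first.
      by rewrite ctmxE !mxE /= (negPf jl) conjC0 mul0r.
    by rewrite ctmxE !mxE /= eqxx conjC1 mul1r addr0.
have SX : diagC nu *m X = X *m rmx c 0 0 (nu l).
  apply/matrixP => j b; rewrite mul_diag_mx [RHS]mxE !big_ord_recl big_ord0 !mxE /=.
  case: b => -[|[|//]] ? /=; rewrite !mulr0 ?addr0 ?add0r.
    have [->|gj] := eqVneq (g j 0) 0; first by rewrite !mulr0 mul0r.
    by rewrite (eg _ gj) mulrC.
  by case: eqP => [->|_]; rewrite ?mulr1 ?mul1r ?mulr0 ?mul0r.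
have [pA potA] := potential_swap phi pS XX SX.
suff -> : A = diagC nu + (c - nu l)%:C *: (X *m rmx (-1) 0 0 1 *m X^t*).
  exact: (conj pA potA).
rewrite /A; congr (_ + _).
have -> : ((c - nu l) / a)%:C = (c - nu l)%:C * (a^-1)%:C by rewrite rmorphM.
rewrite -scalerA; congr (_ *: _); apply/matrixP => i j.
rewrite [RHS]mxE !big_ord_recl big_ord0 addr0 !ctmxE !mxE !big_ord_recl !big_ord0 !mxE /=.
rewrite conjCZ rmorph_nat rmorphN1 !mulr0 !addr0 add0r mulr1 mulrN1.
have -> : (a^-1)%:C = (r^-1)%:C * (r^-1)%:C :> C by rewrite -rmorphM -expr2 exprVn r2.
have ra : (r^-1)%:C * (r^-1)%:C * a%:C = 1 :> C.
  by rewrite -!rmorphM /= -r2 -[RHS]/(1%:C); congr (_%:C); field; rewrite gt_eqF.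
have -> : ((i == l) && (j == l))%:R = (i == l)%:R * (j == l)%:R :> C.
  by rewrite -natrM mulnb.
move: (r^-1)%:C ra => v ra.
move: (g i 0) ((g j 0)^*) (i == l)%:R (j == l)%:R => p q x y.
transitivity (v * v * a%:C * (x * y) - v * v * (p * q)); first by ring.
by rewrite ra; ring.
Qed.

Variables (S : 'M[C]_d) (G : 'M[C]_(d, k)) (nu : 'I_d -> R).
Hypothesis (pS : psd S) (minG : localmin phi S G).
Hypothesis (SGE : S + G *m G^t* = diagC nu).
Variable c : 'I_k -> R.
Hypothesis eigG : forall t j, G j t != 0 -> nu j = c t.
Hypothesis G_gt0 : forall t, 0 < colnsq G t.

(** Replace g_t by C_t g_t + y_t e_l with |C_t|^2 a_t + |y_t|^2 = a_t, where
    a_t = |g_t|^2 and e_l is the l-th basis vector.  If C_t times the conjugate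
    of y_t equals eps z_t for a relation z between the columns, the mixed terms
    of the new frame operator cancel.  What remains is a transfer of mass from
    eigenvectors with eigenvalues c_t > nu l to e_l, which is a small move in the
    convex hull of exchanges of e_l with g_t / sqrt a_t. *)
Lemma localmin_independent l (z : 'cV[C]_k) : G *m z = 0 ->
  (forall t, z t 0 != 0 -> nu l < c t) -> z = 0.
Proof.
move=> Gz zl; have [e e0 min] := minG.
apply/eqP/negPn/negP => /matrix0Pn[t0 [b]]; rewrite {b}ord1 => zt0.
pose n t := nsq (z t 0); have n0 t : 0 <= n t by exact: nsq_ge0.
pose a t := colnsq G t; have a0 t : 0 < a t by exact: G_gt0.
have pSG : psd (diagC nu) by rewrite -SGE; exact: (psdD pS (psd_gram G)).
pose gap t := `|c t - nu l|.
have gap0 t : 0 <= gap t by exact: normr_ge0.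
pose K1 := \sum_t 4 * n t / e.
pose K2 := \sum_t 16 * n t / a t.
pose K3 := \sum_t 4 * n t / gap t.
have K10 : 0 <= K1 by apply: sumr_ge0 => t _; rewrite divr_ge0 ?(ltW e0) // mulr_ge0.
have K20 : 0 <= K2 by apply: sumr_ge0 => t _; rewrite divr_ge0 ?(ltW (a0 t)) // mulr_ge0.
have K30 : 0 <= K3 by apply: sumr_ge0 => t _; rewrite divr_ge0 // mulr_ge0.
have K0 : 0 <= K1 + K2 + K3 by rewrite !addr_ge0.
have [eps [eps0 eps4 epsK]] := small_parameter K0.
have e20 : 0 < eps ^+ 2 by rewrite exprn_gt0.
have bound K : K <= K1 + K2 + K3 -> eps ^+ 2 * K < 1.
  by move=> le; apply: le_lt_trans epsK; rewrite ler_pM2l.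
have term (f : 'I_k -> R) t : (forall u, 0 <= f u) -> f t <= \sum_u f u.
  by move=> f0; rewrite (bigD1 t) //= lerDl sumr_ge0.
have eps1 t : eps ^+ 2 * (4 * n t / e) < 1.
  apply: bound; apply: (@le_trans _ _ K1); last by lra.
  by apply: term => u; rewrite divr_ge0 ?(ltW e0) // mulr_ge0.
have eps2 t : eps ^+ 2 * (16 * n t / a t) < 1.
  apply: bound; apply: (@le_trans _ _ K2); last by lra.
  by apply: (term (fun t => 16 * n t / a t)) => u; rewrite divr_ge0 ?(ltW (a0 u)) // mulr_ge0.
have eps3 : eps ^+ 2 * K3 < 1 by apply: bound; lra.
(* With s_t ^+ 2 * a_t = |y_t|^2, the requirement on y_t reads C_t * s_t = A t. *)
pose A t := eps * Num.sqrt (n t) / Num.sqrt (a t).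
have A2 t : A t ^+ 2 = eps ^+ 2 * n t / a t.
  by rewrite !exprMn exprVn !sqr_sqrtr // ltW.
have A0 t : 0 <= A t by rewrite divr_ge0 ?sqrtr_ge0 // mulr_ge0 ?sqrtr_ge0 // ltW.
have A4 t : 0 <= A t <= 1 / 4.
  rewrite A0 /=; have := eps2 t.
  have -> : eps ^+ 2 * (16 * n t / a t) = 16 * A t ^+ 2 by rewrite A2; ring.
  by move: (A t) (A0 t) => x x0 h; nra.
have [p hp] := fin_all_exists (fun t => small_rotation (A4 t)).
pose Cs t := (p t).1; pose s t := (p t).2.
have C0 t : 0 < Cs t by case: (hp t) => -[].
have s0 t : 0 <= s t by case: (hp t) => -[].
have C2 t : Cs t ^+ 2 = 1 - s t ^+ 2.
  by case: (hp t) => -[_ _ <- _ _] _; rewrite /Cs /s addrK.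
have Cs_A t : Cs t * s t = A t by case: (hp t) => -[].
have C1 t : 1 - Cs t <= 2 * A t ^+ 2 by case: (hp t) => _ [].
have s2 t : s t ^+ 2 <= 2 * A t ^+ 2.
  case: (hp t) => -[_ _ _ _ /andP[_ le]] _; apply: (le_trans le).
  have -> : A t ^+ 4 = A t ^+ 2 * A t ^+ 2 by rewrite -exprD.
  have : A t ^+ 2 <= 1 / 16 by have /andP[? ?] := A4 t; nra.
  have := sqr_ge0 (A t); move: (A t ^+ 2) => x; nra.
have Cunit t : Cs t != 0 by rewrite gt_eqF.
have sn t : s t ^+ 2 * Cs t ^+ 2 * a t = eps ^+ 2 * n t.
  have -> : s t ^+ 2 * Cs t ^+ 2 * a t = (Cs t * s t) ^+ 2 * a t by ring.
  by rewrite Cs_A A2 divfK // gt_eqF.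
pose y t : C := (eps / Cs t)%:C * (z t 0)^*.
have ny t : nsq (y t) = s t ^+ 2 * a t.
  rewrite /y nsqM nsqR nsq_conj -/(n t) expr_div_n.
  have := sn t; move=> e1; apply: (mulIf (expf_neq0 2 (Cunit t))).
  rewrite mulrAC divfK ?expf_neq0 // -e1; ring.
have zG t : z t 0 != 0 -> G l t = 0.
  move=> zt; have [//|/eigG e1] := eqVneq (G l t) 0.
  by have := zl t zt; rewrite -e1 ltxx.
have y0 t : z t 0 = 0 -> y t = 0 by move=> zt; rewrite /y zt conjC0 mulr0.
have sz t : z t 0 = 0 -> s t = 0.
  move=> zt; apply/eqP; rewrite -(sqrf_eq0 (s t)); apply/eqP.
  by apply: (mulIf (lt0r_neq0 (a0 t))); rewrite -ny y0 // mul0r; apply/eqP; rewrite nsq_eq0.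
have yG t : y t = 0 \/ G l t = 0.
  have [/y0 ->|/zG ->] := eqVneq (z t 0) 0; by [left|right].
pose G' : 'M[C]_(d, k) := \matrix_(j, t) ((Cs t)%:C * G j t + y t * (j == l)%:R).
have nsq00 : nsq (0 : C) = 0 by apply/eqP; rewrite nsq_eq0.
have colE (v : 'I_k -> R) t : \sum_j nsq ((v t)%:C * G j t + y t * (j == l)%:R) =
    v t ^+ 2 * a t + nsq (y t).
  rewrite [LHS](bigD1 l) //= eqxx mulr1.
  have -> : a t = nsq (G l t) + \sum_(j | j != l) nsq (G j t) by rewrite /a /colnsq (bigD1 l).
  have -> : \sum_(j | j != l) nsq ((v t)%:C * G j t + y t * (j == l)%:R) =
      v t ^+ 2 * \sum_(j | j != l) nsq (G j t).
    rewrite mulr_sumr; apply: eq_bigr => j /negPf jl.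
    by rewrite jl mulr0 addr0 nsqM nsqR.
  case: (yG t) => ->; rewrite ?mulr0 ?addr0 ?add0r ?nsqM ?nsqR; ring.
have nG' t : colnsq G' t = colnsq G t.
  rewrite -/(a t) /colnsq.
  under eq_bigr do rewrite mxE.
  by rewrite (colE Cs) ny C2; ring.
have dG' t : colnsq (G' - G) t < e.
  have -> : colnsq (G' - G) t = (Cs t - 1) ^+ 2 * a t + nsq (y t).
    rewrite -(colE (fun t => Cs t - 1)); apply: eq_bigr => j _; congr nsq.
    by rewrite !mxE rmorphB /=; ring.
  rewrite ny -mulrDl.
  have -> : (Cs t - 1) ^+ 2 + s t ^+ 2 = 2 * (1 - Cs t).
    by have := C2 t; lra.
  apply: (@le_lt_trans _ _ (2 * (2 * A t ^+ 2) * a t)).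
    by rewrite ler_pM2r // ler_pM2l.
  rewrite A2; have -> : 2 * (2 * (eps ^+ 2 * n t / a t)) * a t = eps ^+ 2 * (4 * n t / e) * e.
    by field; rewrite !gt_eqF.
  by rewrite gtr_pMl.
(* The columns with z t 0 = 0 do not move and take part with weight zero. *)
pose B t := if z t 0 == 0 then diagC nu else
  diagC nu + ((c t - nu l) / a t)%:C *: ((a t)%:C *: delta_mx l l - col t G *m (col t G)^t*).
pose w t := if z t 0 == 0 then 0 else s t ^+ 2 * a t / (c t - nu l).
have pB t : psd (B t) /\ potential (B t) <= potential (diagC nu).
  rewrite /B; case: eqVneq => [_|zt]; first by split.
  have [||||pX eX] := @potential_move_mass nu (col t G) l (c t) (a t) pSG (a0 t).
  - by apply: eq_bigr => j _; rewrite mxE.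
  - by rewrite mxE zG.
  - exact: zl.
  - by move=> j; rewrite mxE; exact: eigG.
  by split; [exact: pX | rewrite eX].
have w0 t : 0 <= w t.
  rewrite /w; case: eqVneq => // zt; rewrite divr_ge0 ?subr_ge0 ?(ltW (zl t zt)) //.
  by rewrite mulr_ge0 ?sqr_ge0 // ltW.
have w1 : \sum_t w t < 1 / 2.
  apply: (@le_lt_trans _ _ (eps ^+ 2 * K3 / 2)); last by move: eps3; lra.
  rewrite /K3 mulr_sumr mulr_suml; apply: ler_sum => t _; rewrite /w.
  case: eqVneq => [_|zt].
    by rewrite !mulr_ge0 // ?invr_ge0 // ltW.
  have ct := zl t zt; have gapE : gap t = c t - nu l by rewrite /gap ger0_norm // subr_ge0 ltW.
  rewrite gapE ler_pdivrMr ?subr_gt0 //.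
  have -> : eps ^+ 2 * (4 * n t / (c t - nu l)) / 2 * (c t - nu l) = 2 * A t ^+ 2 * a t.
    by rewrite A2; field; rewrite ?gt_eqF //= subr_gt0.
  by rewrite ler_pM2r.
have wB t : (w t)%:C *: (B t - diagC nu) =
    (s t ^+ 2)%:C *: ((a t)%:C *: delta_mx l l - col t G *m (col t G)^t*).
  rewrite /w /B; case: eqVneq => [zt|zt].
    by rewrite subrr scaler0 sz // expr0n /= scale0r.
  rewrite addrAC subrr add0r scalerA -rmorphM /=; congr (_%:C *: _).
  by field; rewrite !gt_eqF // subr_gt0 zl.
have wBE t i j : ((w t)%:C *: (B t - diagC nu)) i j =
    (s t ^+ 2)%:C * ((a t)%:C * ((i == l) && (j == l))%:R - G i t * (G j t)^*).
  have gE : (col t G *m (col t G)^t*) i j = G i t * (G j t)^*.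
    by rewrite mxE big_ord1 ctmxE !mxE.
  rewrite wB mxE; congr (_ * _); rewrite mxE; congr (_ + _).
    by rewrite !mxE.
  by rewrite mxE gE.
have sumwB : \sum_t (w t)%:C *: (B t - diagC nu) = G' *m G'^t* - G *m G^t*.
  apply/matrixP => i j; rewrite summxE mxE [X in _ + X]mxE !gramE -sumrB.
  transitivity (\sum_t (((s t ^+ 2 * a t)%:C * ((i == l) && (j == l))%:R
                    - (s t ^+ 2)%:C * (G i t * (G j t)^*))
     + eps%:C * (j == l)%:R * (G i t * z t 0) + eps%:C * (i == l)%:R * (G j t * z t 0)^*)); last first.
    apply: eq_bigr => t _; rewrite !mxE.
    have -> : ((Cs t)%:C * G j t + y t * (j == l)%:R)^* =
        (Cs t)%:C * (G j t)^* + (y t)^* * (j == l)%:R.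
      by rewrite rmorphD /= conjCZ rmorphM /= conjC_nat.
    have CE : (Cs t)%:C * (eps / Cs t)%:C = eps%:C :> C.
      by rewrite -rmorphM mulrC divfK.
    have CY : (Cs t)%:C * (y t)^* = eps%:C * z t 0.
      by rewrite /y conjCZ conjCK mulrA CE.
    have CYt : (Cs t)%:C * y t = eps%:C * (z t 0)^*.
      by rewrite /y mulrA CE.
    have CC : (Cs t)%:C * (Cs t)%:C = 1 - (s t ^+ 2)%:C :> C.
      by rewrite -rmorphM -expr2 C2 rmorphB.
    have -> : (s t ^+ 2 * a t)%:C = y t * (y t)^* :> C by rewrite -nsqE ny.
    have -> : ((i == l) && (j == l))%:R = (i == l)%:R * (j == l)%:R :> C.
      by rewrite -natrM mulnb.
    rewrite [(G j t * z t 0)^*]rmorphM /=.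
    transitivity ((Cs t)%:C * (Cs t)%:C * (G i t * (G j t)^*) - G i t * (G j t)^*
       + (Cs t)%:C * (y t)^* * (j == l)%:R * G i t
       + (Cs t)%:C * y t * (i == l)%:R * (G j t)^* 
       + y t * (y t)^* * ((i == l)%:R * (j == l)%:R)); last by ring.
    by rewrite CC CY CYt; ring.
  have Gz0 m : \sum_t G m t * z t 0 = 0.
    by have /matrixP/(_ m 0) := Gz; rewrite !mxE.
  rewrite !big_split /= -!mulr_sumr Gz0 -rmorph_sum Gz0 rmorph0 !mulr0 !addr0 -big_split /=.
  by apply: eq_bigr => t _; rewrite wBE rmorphM /=; ring.
have ne0 : \sum_t (w t)%:C *: (B t - diagC nu) != 0.
  apply/eqP => /matrixP/(_ l l); rewrite summxE [RHS]mxE.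
  suff : 0 < \sum_t s t ^+ 2 * a t.
    move=> pos sum0; suff e1 : \sum_t s t ^+ 2 * a t = 0 by rewrite e1 ltxx in pos.
    apply: complexI; rewrite rmorph_sum -[RHS]sum0; apply: eq_bigr => t _.
    rewrite wBE eqxx mulr1 /=.
    have [zt|/zG ->] := eqVneq (z t 0) 0; last by rewrite mul0r subr0 rmorphM.
    by rewrite sz // expr0n !mul0r.
  rewrite (bigD1 t0) //= ltr_wpDr ?sumr_ge0 // => [t _|].
    by rewrite mulr_ge0 ?sqr_ge0 // ltW.
  rewrite -ny lt_def nsq_ge0 nsq_eq0 /y mulf_eq0 conjC_eq0 (negPf zt0) orbF andbT.
  rewrite -[0]/(0%:C) (inj_eq (@complexI R)) mulf_eq0 invr_eq0 (negPf (Cunit t0)).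
  by rewrite gt_eqF.
have := potential_hull_lt phi_sconvex pSG (fun t => (pB t).1) (fun t => (pB t).2) w0 w1 ne0.
rewrite sumwB -SGE addrA.
have -> : S + G *m G^t* + G' *m G'^t* - G *m G^t* = S + G' *m G'^t*.
  move: (G *m _) (G' *m _) => M1 M2.
  by apply/matrixP => i j; rewrite !mxE; ring.
by rewrite ltNge (min _ nG' dG').
Qed.

End Indep.

(** * Ky Fan inequality *)

Section KyFan.
Variables (R : realType) (d : nat).
Local Notation C := R[i].

Lemma nsq_mxtrace m n (A : 'M[C]_(m, n)) :
  \sum_i \sum_j nsq (A i j) = complex.Re (\tr (A *m A^t*)).
Proof.
rewrite raddf_sum; apply: eq_bigr => i _ /=.
rewrite mxE raddf_sum; apply: eq_bigr => j _ /=.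
by rewrite ctmxE -nsqE.
Qed.

(** The sum is a diagonal entry of the orthogonal projection Y^* Y. *)
Lemma coisometry_col_le1 m (Y : 'M[C]_(m, d)) i : Y *m Y^t* = 1%:M ->
  \sum_b nsq (Y b i) <= 1.
Proof.
move=> YY; pose P := Y^t* *m Y.
have PE : P i i = (\sum_b nsq (Y b i))%:C.
  by rewrite mxE rmorph_sum; apply: eq_bigr => b _ /=; rewrite ctmxE nsqE mulrC.
have PP : P *m P^t* = P.
  by rewrite /P ctmx_mul trmxCK -mulmxA (mulmxA Y) YY mul1mx.
set x := \sum_b _ in PE *.
have xE : x = \sum_j nsq (P i j).
  apply: complexI; rewrite -PE -{1}PP mxE rmorph_sum; apply: eq_bigr => j _ /=.
  by rewrite ctmxE nsqE.
have : x ^+ 2 <= x.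
  rewrite {2}xE (bigD1 i) //= PE nsqR lerDl sumr_ge0 // => j _.
  exact: nsq_ge0.
by move: x {xE PE} => x; nra.
Qed.

Lemma coisometry_trace m (Y : 'M[C]_(m, d)) : Y *m Y^t* = 1%:M ->
  \sum_i \sum_b nsq (Y b i) = m%:R.
Proof.
move=> YY; rewrite exchange_big nsq_mxtrace YY mxtrace1.
by rewrite -(rmorph_nat (real_complex R)).
Qed.

Lemma trace_diagC m (Y : 'M[C]_(m, d)) (l : 'I_d -> R) :
  complex.Re (\tr (Y *m diagC l *m Y^t*)) = \sum_i l i * \sum_b nsq (Y b i).
Proof.
rewrite raddf_sum /=.
transitivity (\sum_b \sum_i l i * nsq (Y b i)).
  apply: eq_bigr => b _; rewrite mxE raddf_sum; apply: eq_bigr => i _ /=.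
  by rewrite mul_mx_diag ctmxE !mxE mulrAC -nsqE -rmorphM /= mulrC.
by rewrite exchange_big; apply: eq_bigr => i _; rewrite mulr_sumr.
Qed.

(** In an eigenbasis, the trace weighs the eigenvalues l i with numbers in [0, 1]
    that add up to m; bounding a weighted sum of the l i - h by the sum of their
    positive parts avoids sorting the spectrum. *)
Lemma ky_fan_hinge m (Y : 'M[C]_(m, d)) (Q : 'M[C]_d) (l : 'I_d -> R) (h : R) :
  Y *m Y^t* = 1%:M -> Q \is unitarymx ->
  complex.Re (\tr (Y *m (Q^t* *m diagC l *m Q) *m Y^t*)) - m%:R * h
    <= \sum_i Num.max (l i - h) 0.
Proof.
move=> YY uQ; pose W := Y *m Q^t*.
have WW : W *m W^t* = 1%:M.
  by rewrite ctmx_mul trmxCK -mulmxA (mulmxA _ Q) unitary_mulVmx // mul1mx.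
have -> : Y *m (Q^t* *m diagC l *m Q) *m Y^t* = W *m diagC l *m W^t*.
  by rewrite ctmx_mul trmxCK !mulmxA.
rewrite trace_diagC -(coisometry_trace WW) mulr_suml -sumrB; apply: ler_sum => i _.
rewrite mulrC -mulrBr.
have := coisometry_col_le1 i WW; have : 0 <= \sum_b nsq (W b i).
  by apply: sumr_ge0 => b _; exact: nsq_ge0.
move: (\sum_b _) => w w0 w1; rewrite le_max.
by case: (lerP (l i - h) 0) => lh; apply/orP; [right|left]; nra.
Qed.

(** The vectors span a space of dimension at most m, which Gram-Schmidt completes
    to dimension exactly m: the multiple of h in [ky_fan_hinge] is the dimension
    of the space, and [global_diag] needs it to be the size of E. *)
Lemma coisometry_span m (vs : seq 'rV[C]_d) : (size vs <= m)%N -> (m <= d)%N ->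
  exists2 Y : 'M[C]_(m, d), Y *m Y^t* = 1%:M &
    forall v, v \in vs -> v *m Y^t* *m Y = v.
Proof.
move=> sm md; pose A : 'M[C]_(m, d) := \matrix_(b < m) nth 0 vs b.
have /unitarymxP YY := schmidt_unitarymx A md.
exists (schmidt A) => // v /(nthP 0)[b bs <-].
have bm : (b < m)%N by exact: leq_trans bs sm.
have : (row (Ordinal bm) A <= schmidt A)%MS by rewrite (submx_trans (row_sub _ _)) // schmidt_sub.
rewrite rowK /= => /submxP[u ->].
by rewrite -(mulmxA u) YY mulmx1.
Qed.

End KyFan.

(** * From the structure to global minimality *)

(** The hypotheses below are the structure of a local minimizer in a common
    eigenbasis of S + G G^* and G G^*; al i in the introduction is nu i - mu i,
    the i-th eigenvalue of S. *)
Section Global.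
Variables (R : realType) (d k : nat).
Local Notation C := R[i].
Variable phi : R -> R.
Hypothesis phi_sconvex : strictly_convex_nonneg phi.
Local Notation potential := (@potential R d phi).

Variables (S : 'M[C]_d) (G : 'M[C]_(d, k)) (nu mu : 'I_d -> R).
Hypothesis (pS : psd S).
Hypothesis (SGE : S + G *m G^t* = diagC nu) (GGE : G *m G^t* = diagC mu).
Variable c : 'I_k -> R.
Hypothesis eigG : forall t j, G j t != 0 -> nu j = c t.
Hypothesis opposite : forall i l, 0 < mu i -> nu l < nu i -> nu i - mu i <= nu l - mu l.
Hypothesis indep : forall l (z : 'cV[C]_k), G *m z = 0 ->
  (forall t, z t 0 != 0 -> nu l < c t) -> z = 0.

Lemma gram_rowE i : mu i = \sum_t nsq (G i t).
Proof.
apply: complexI; have /matrixP/(_ i i) := GGE; rewrite gramE diagCE eqxx mulr1n => <-.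
by rewrite rmorph_sum; apply: eq_bigr => t _ /=; rewrite nsqE.
Qed.

Lemma S0_diagE : S = diagC (fun i => nu i - mu i).
Proof.
have -> : S = diagC nu - diagC mu by rewrite -SGE -GGE addrK.
apply/matrixP => i j; rewrite mxE [X in _ + X]mxE !diagCE.
by case: (i == j); rewrite ?mulr1n ?mulr0n ?subr0 // rmorphB.
Qed.

(** The columns with c t > h are supported on the rows i with nu i = c t, where
    mu i > 0.  More columns than such rows would be linearly dependent. *)
Lemma card_independent h l : nu l <= h ->
  (#|[pred t | (h < c t)%R]| <= #|[pred i | (h < nu i)%R && (0 < mu i)%R]|)%N.
Proof.
move=> lh; set J := [pred t | _]; set W := [pred i | _].
rewrite leqNgt; apply/negP => lt.
pose H : 'M[C]_(#|J|, #|W|) := \matrix_(x, b) G (enum_val b) (enum_val x).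
have kerH : kermx H != 0.
  rewrite kermx_eq0; apply/negP => /eqP free.
  by have := rank_leq_col H; rewrite free leqNgt lt.
have [x /eqP kx] : exists x, row x (kermx H) != 0.
  apply/existsP; rewrite -negb_forall; apply: contra kerH => /forallP r0.
  by apply/eqP/row_matrixP => x; rewrite row0; apply/eqP/r0.
pose u := row x (kermx H).
have uH : u *m H = 0 by rewrite -row_mul mulmx_ker row0.
pose z : 'cV[C]_k := \col_t \sum_y u 0 y * (enum_val y == t)%:R.
have zE y : z (enum_val y) 0 = u 0 y.
  rewrite mxE (bigD1 y) //= eqxx mulr1 big1 ?addr0 // => y' yy'.
  by rewrite (inj_eq enum_val_inj) (negPf yy') mulr0.
have zJ t : z t 0 != 0 -> t \in J.
  apply: contraR => tJ; apply/eqP; rewrite mxE big1 // => y _.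
  case: eqP => [e|_]; last by rewrite mulr0.
  by move: tJ; rewrite -e enum_valP.
have Gz : G *m z = 0.
  apply/colP => j; rewrite [LHS]mxE [RHS]mxE.
  transitivity (\sum_y u 0 y * G j (enum_val y)).
    rewrite (bigID (mem J)) /= [X in _ + X]big1 ?addr0; last first.
      by move=> t tJ; have [->|/zJ tJ'] := eqVneq (z t 0) 0; [rewrite mulr0|rewrite tJ' in tJ].
    rewrite big_enum_val /=; apply: eq_bigr => y _.
    by rewrite zE mulrC.
  have [jW|jW] := boolP (j \in W).
    have /rowP/(_ (enum_rank_in jW j)) := uH; rewrite [LHS]mxE [RHS]mxE => e.
    rewrite -[RHS]e; apply: eq_bigr => y _.
    by rewrite [H _ _]mxE enum_rankK_in.
  rewrite big1 // => y _; have [->|Gj] := eqVneq (G j (enum_val y)) 0; first by rewrite mulr0.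
  case/negP: jW; rewrite inE (eigG Gj) (enum_valP y : h < c _) /= gram_rowE.
  rewrite (bigD1 (enum_val y)) //= ltr_pwDl //.
    by rewrite lt_def nsq_eq0 Gj nsq_ge0.
  by apply: sumr_ge0 => t _; exact: nsq_ge0.
have z0 : z = 0.
  apply: (@indep l) => // t /zJ; rewrite inE; exact: le_lt_trans.
by apply: kx; apply/rowP => y; rewrite -/u -zE z0 !mxE.
Qed.

(** The inequality between hinge sums is proved by the projection argument of the
    introduction; below, p i are the diagonal entries of the projection Y^* Y. *)
Lemma global_diag (G' : 'M[C]_(d, k)) : (forall t, colnsq G' t = colnsq G t) ->
  potential (S + G *m G^t*) <= potential (S + G' *m G'^t*).
Proof.
move=> nG'; have pS' := psdD pS (psd_gram G').
have [Q [l [uQ eS']]] := hermitian_spectral pS'.1.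
have l0 : forall i, 0 <= l i by apply: (psd_eig_ge0 uQ); rewrite -eS'.
have u1 : (1%:M : 'M[C]_d) \is unitarymx by apply/unitarymxP; rewrite ctmx1 mulmx1.
have potG : potential (S + G *m G^t*) = \sum_i phi (nu i).
  by have := potential_spectral phi nu u1; rewrite ctmx1 mul1mx mulmx1 SGE.
rewrite potG eS' (potential_spectral phi l uQ).
have nu0 : forall i, 0 <= nu i.
  apply: (psd_eig_ge0 u1); rewrite ctmx1 mul1mx mulmx1 -SGE.
  exact: (psdD pS (psd_gram G)).
have trE (H : 'M[C]_(d, k)) : complex.Re (\tr (H *m H^t*)) = \sum_t colnsq H t.
  by rewrite -nsq_mxtrace exchange_big.
have trS (A : 'M[C]_d) (P : 'M[C]_d) x : P \is unitarymx -> A = P^t* *m diagC x *m P ->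
    complex.Re (\tr A) = \sum_i x i.
  move=> uP ->; rewrite (mxtrace_unitary _ uP) mxtrace_diag raddf_sum.
  by apply: eq_bigr => i _ /=; rewrite mxE.
have sum_eq : \sum_i l i = \sum_i nu i.
  rewrite -(trS _ _ _ uQ eS') mxtraceD raddfD /= trE.
  rewrite (eq_bigr _ (fun t _ => nG' t)) -trE -raddfD -mxtraceD SGE.
  by rewrite mxtrace_diag raddf_sum; apply: eq_bigr => i _ /=; rewrite mxE.
apply: (karamata phi_sconvex l0 nu0 sum_eq) => h.
pose E := [pred i | h < nu i].
have hingeE : \sum_i Num.max (nu i - h) 0 = \sum_(i in E) (nu i - h).
  rewrite [RHS]big_mkcond /=; apply: eq_bigr => i _; rewrite inE maxC /Num.max subr_gt0.
  by [].
have [/forallP allE|] := boolP [forall i, i \in E].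
  rewrite hingeE (eq_bigl xpredT); last by move=> i; rewrite allE.
  rewrite sumrB -sum_eq -sumrB; apply: ler_sum => i _.
  by rewrite le_max lexx.
rewrite negb_forall => /existsP[l1 l1E].
have {}l1E : nu l1 <= h by move: l1E; rewrite inE -leNgt.
pose W := [pred i | (h < nu i) && (0 < mu i)].
pose W0 := [pred i | (h < nu i) && ~~ (0 < mu i)].
pose J := [pred t | h < c t].
have cardWJ : (#|W0| + #|J| <= #|E|)%N.
  apply: (@leq_trans (#|W0| + #|W|)%N).
    by rewrite leq_add2l; exact: card_independent l1E.
  rewrite addnC -(cardID W E) leq_eqVlt; apply/orP; left; apply/eqP; congr (_ + _)%N.
    by apply: eq_card => i; rewrite !inE; case: (h < nu i).
  by apply: eq_card => i; rewrite !inE; case: (h < nu i); rewrite /= ?andbT ?andbF.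
pose vs := [seq (delta_mx 0 i : 'rV[C]_d) | i <- enum W0] ++ [seq (col t G')^t* | t <- enum J].
have [||Y YY Yvs] := @coisometry_span R d #|E| vs.
- by rewrite size_cat !size_map -!cardE.
- by have := max_card E; rewrite card_ord.
pose p i := \sum_b nsq (Y b i).
have p0 i : 0 <= p i by apply: sumr_ge0 => b _; exact: nsq_ge0.
have p1 i : p i <= 1 by exact: coisometry_col_le1.
have sump : \sum_i p i = #|E|%:R by exact: coisometry_trace.
have pW0 i : i \in W0 -> p i = 1.
  move=> iW0; have /Yvs : (delta_mx 0 i : 'rV[C]_d) \in vs.
    by rewrite mem_cat map_f // mem_enum.
  rewrite -mulmxA -rowE => /rowP/(_ i); rewrite !mxE !eqxx /= => e.
  apply: complexI; rewrite -[RHS]e rmorph_sum; apply: eq_bigr => b _ /=.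
  by rewrite nsqE ctmxE mulrC.
have YG' t : t \in J -> \sum_b nsq ((Y *m G') b t) = colnsq G' t.
  move=> tJ; have /Yvs e : (col t G')^t* \in vs.
    by rewrite mem_cat (map_f (fun t => (col t G')^t*)) ?orbT // mem_enum.
  apply: complexI; rewrite rmorph_sum /=.
  transitivity (((Y *m G')^t* *m (Y *m G')) t t).
    by rewrite mxE; apply: eq_bigr => b _; rewrite ctmxE nsqE mulrC.
  rewrite colnsqE.
  have ent (A : 'M[C]_d) : (G'^t* *m A *m G') t t = ((col t G')^t* *m A *m col t G') 0 0.
    have -> : (col t G')^t* = row t (G'^t*) by apply/rowP => j; rewrite !mxE.
    rewrite -row_mul [LHS]mxE [RHS]mxE; apply: eq_bigr => j _.
    by rewrite [row _ _ _ _]mxE [col _ _ _ _]mxE.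
  have := ent (Y^t* *m Y); rewrite !mulmxA e ctmx_mul => ->.
  by have := ent 1%:M; rewrite !mulmx1.
have trY : complex.Re (\tr (Y *m (S + G' *m G'^t*) *m Y^t*)) =
    \sum_i (nu i - mu i) * p i + \sum_t \sum_b nsq ((Y *m G') b t).
  rewrite mulmxDr mulmxDl mxtraceD raddfD /= {1}S0_diagE trace_diagC; congr (_ + _).
  by rewrite exchange_big nsq_mxtrace ctmx_mul !mulmxA.
have := ky_fan_hinge l h YY uQ; rewrite -eS' trY; apply: le_trans.
rewrite hingeE sumrB sumr_const -[h *+ _]mulr_natl lerD2r.
have sumJ : \sum_(i in E) mu i <= \sum_t \sum_b nsq ((Y *m G') b t).
  rewrite [leRHS](bigID (mem J)) /= -[leLHS]addr0; apply: lerD; last first.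
    by apply: sumr_ge0 => t _; apply: sumr_ge0 => b _; exact: nsq_ge0.
  rewrite (eq_bigr (colnsq G)); last by move=> t /YG' ->.
  rewrite (eq_bigr _ (fun i _ => gram_rowE i)) exchange_big /= (bigID (mem J)) /=.
  rewrite [X in _ + X]big1 ?addr0; last first.
    move=> t tJ; rewrite big1 // => i iE; apply/eqP; rewrite nsq_eq0.
    by apply: contraNT tJ => /eigG e; rewrite inE -e.
  apply: ler_sum => t tJ; rewrite /colnsq [leRHS](bigID (mem E)) /= lerDl.
  by apply: sumr_ge0 => i _; exact: nsq_ge0.
pose al i := nu i - mu i.
have sumA : \sum_(i in E) al i <= \sum_i al i * p i.
  have l1E' : l1 \notin E by rewrite inE -leNgt.
  (* al l2 separates the rows in E with mu i > 0, where al is smaller and p i <= 1,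
   from the rows outside E, where al is larger and p i >= 0. *)
  pose l2 := [arg min_(i < l1 | i \notin E) al i]%O.
  have [l2E l2min] : l2 \notin E /\ forall i, i \notin E -> al l2 <= al i.
    by rewrite /l2; case: arg_minP.
  have : 0 <= \sum_i (al i - al l2) * (p i - (i \in E)%:R).
    apply: sumr_ge0 => i _; have [iE|iE] := boolP (i \in E); last first.
      by rewrite subr0 mulr_ge0 ?subr_ge0 ?l2min.
    have [mi|mi] := boolP (0 < mu i).
      rewrite mulr_le0 // ?subr_le0 //; apply: opposite => //.
      by apply: (le_lt_trans _ iE); rewrite leNgt.
    by rewrite pW0 ?subrr ?mulr0 // inE mi andbT.
  have -> : \sum_i (al i - al l2) * (p i - (i \in E)%:R) =
      \sum_i al i * p i - \sum_(i in E) al i - al l2 * (\sum_i p i - \sum_i (i \in E)%:R).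
    rewrite [\sum_(i in E) _]big_mkcond /= -!sumrB mulr_sumr -sumrB.
    by apply: eq_bigr => i _; case: (i \in E); rewrite /=; ring.
  rewrite sump (_ : \sum_i (i \in E)%:R = #|E|%:R) ?subrr ?mulr0 ?subr0 ?subr_ge0 //.
  by rewrite -sum1_card natr_sum [RHS]big_mkcond /=; apply: eq_bigr => i _; case: (i \in E).
have -> : \sum_(i in E) nu i = \sum_(i in E) al i + \sum_(i in E) mu i.
  by rewrite -big_split; apply: eq_bigr => i _; rewrite /al /= subrK.
exact: lerD.
Qed.

End Global.

(** * Local minimizers are global minimizers *)

Section Assembly.
Variables (R : realType) (d k : nat).
Local Notation C := R[i].
Variable phi : R -> R.
Hypothesis phi_sconvex : strictly_convex_nonneg phi.
Local Notation potential := (@potential R d phi).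

Lemma diagC_mulE m n (l : 'I_m -> R) (Y : 'M[C]_(m, n)) i j :
  (diagC l *m Y) i j = (l i)%:C * Y i j.
Proof. by rewrite mul_diag_mx mxE; congr (_ * _); rewrite mxE. Qed.

Lemma mul_diagCE m n (l : 'I_n -> R) (Y : 'M[C]_(m, n)) i j :
  (Y *m diagC l) i j = Y i j * (l j)%:C.
Proof. by rewrite mul_mx_diag mxE; congr (_ * _); rewrite mxE. Qed.

(** A and B are the real and the imaginary part of the matrix A + i B, which is
    normal because they commute. *)
Lemma codiagonalize (A B : 'M[C]_d) : A^t* = A -> B^t* = B -> A *m B = B *m A ->
  exists P : 'M[C]_d, exists x y : 'I_d -> R,
    [/\ P \is unitarymx, P *m A *m P^t* = diagC x & P *m B *m P^t* = diagC y].
Proof.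
move=> hA hB AB; pose I : C := 'i%C; pose Z := A + I *: B.
have cI : I^* = - I by apply/eqP; rewrite eq_complex /= oppr0 !eqxx.
have Zt : Z^t* = A - I *: B.
  rewrite ctmxD hA; congr (_ + _).
  by rewrite linearZ map_mxZ /= hB cI scaleNr.
have nZ : Z \is normalmx.
  apply/normalmxP; rewrite Zt /Z !(mulmxDl, mulmxDr, mulNmx, mulmxN).
  rewrite -!scalemxAl -!scalemxAr AB.
  move: (A *m A) (B *m A) (I *: (B *m B)) => M1 M2 M3.
  by apply/matrixP => i j; rewrite !mxE; ring.
have uP := spectral_unitarymx Z.
have eZ := orthomx_spectralP nZ; rewrite invmx_unitary // in eZ.
move: (spectralmx Z) (spectral_diag Z) uP eZ => P z uP eZ.
have PZ : P *m Z *m P^t* = diag_mx z by rewrite eZ (unitary_conjVK _ uP).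
have PZt : P *m Z^t* *m P^t* = (diag_mx z)^t*.
  by rewrite -PZ !ctmx_mul trmxCK mulmxA.
exists P, (fun i => complex.Re (z 0 i)), (fun i => complex.Im (z 0 i)); split=> //.
- have eA : A = (1 / 2)%:C *: (Z + Z^t*).
    rewrite Zt /Z; move: (I *: B) => M; apply/matrixP => i j; rewrite !mxE.
    have -> : (1 / 2)%:C = 2^-1 :> C by rewrite mul1r fmorphV rmorph_nat.
    by field.
  rewrite eA -scalemxAr -scalemxAl mulmxDr mulmxDl PZ PZt.
  apply/matrixP => i j; rewrite diagCE !mxE.
  have [->|_] := eqVneq i j; last by rewrite !mulr0n rmorph0 addr0 mulr0.
  rewrite !mulr1n; case: (z 0 j) => x y; apply/eqP; rewrite eq_complex /=.
  by apply/andP; split; apply/eqP; field.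
- have eB : B = (1 / 2)%:C *: (- I *: (Z - Z^t*)).
    have II : I * I = -1 by rewrite -expr2 sqr_i.
    rewrite Zt /Z; apply/matrixP => i j; rewrite !mxE.
    have -> : (1 / 2)%:C = 2^-1 :> C by rewrite mul1r fmorphV rmorph_nat.
    move: (A i j) (B i j) => a b.
    transitivity (- (I * I) * b); first by rewrite II; ring.
    by field.
  rewrite eB -!scalemxAr -!scalemxAl mulmxBr mulmxBl PZ PZt.
  apply/matrixP => i j; rewrite diagCE !mxE.
  have [->|_] := eqVneq i j; last by rewrite !mulr0n rmorph0 subr0 !mulr0.
  rewrite !mulr1n; case: (z 0 j) => x y; apply/eqP; rewrite eq_complex /=.
  by apply/andP; split; apply/eqP; field.
Qed.

Lemma localmin_global (S : 'M[C]_d) (G G' : 'M[C]_(d, k)) :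
  psd S -> localmin phi S G -> (forall t, 0 < colnsq G t) ->
  (forall t, colnsq G' t = colnsq G t) ->
  potential (S + G *m G^t*) <= potential (S + G' *m G'^t*).
Proof.
move=> pS minG G0 nG'.
have [c eigc] := fin_all_exists (fun t => localmin_eigen phi_sconvex t pS minG).
pose A := S + G *m G^t*; pose B := G *m G^t*.
have hB : B^t* = B by rewrite ctmx_mul trmxCK.
have hA : A^t* = A by rewrite ctmxD pS.1 hB.
have AG : A *m G = G *m diagC c.
  apply/matrixP => j t.
  have : col t (A *m G) = (c t)%:C *: col t G by rewrite colE -mulmxA -colE eigc.
  move=> /colP/(_ j); rewrite [LHS]mxE [RHS]mxE [col t G _ _]mxE => ->.
  by rewrite mul_diagCE mulrC.
have AB : A *m B = B *m A.
  have eAB : A *m B = G *m diagC c *m G^t* by rewrite /B mulmxA AG.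
  have hAB : (A *m B)^t* = A *m B.
    by rewrite eAB !ctmx_mul trmxCK ctmx_diagC mulmxA.
  by rewrite -hAB ctmx_mul hA hB.
have [P [nu [mu [uP eA eB]]]] := codiagonalize hA hB AB.
rewrite -(potential_unitary_gram phi G uP pS) -(potential_unitary_gram phi G' uP pS).
have pS' := psd_conj P pS.
have min' := localmin_unitary uP pS minG.
have GGE : P *m G *m (P *m G)^t* = diagC mu by rewrite -eB ctmx_mul !mulmxA.
have SGE : P *m S *m P^t* + P *m G *m (P *m G)^t* = diagC nu.
  by rewrite -eA ctmx_mul /A mulmxDr mulmxDl !mulmxA.
have eig t j : (P *m G) j t != 0 -> nu j = c t.
  move=> Gj; apply: complexI; apply: (mulIf Gj).
  have : diagC nu *m (P *m G) = P *m G *m diagC c.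
    by rewrite -eA -!mulmxA (mulmxA _ P) (unitary_mulVmx uP) mul1mx AG.
  by move=> /matrixP/(_ j t); rewrite diagC_mulE mul_diagCE => ->; rewrite mulrC.
have G0' t : 0 < colnsq (P *m G) t by rewrite colnsq_unitary.
apply: (global_diag phi_sconvex pS' SGE GGE eig).
- exact: (localmin_opposite phi_sconvex pS' min' SGE GGE eig).
- exact: (localmin_independent phi_sconvex pS' min' SGE eig G0').
- by move=> t; rewrite !(colnsq_unitary _ _ uP) nG'.
Qed.

Definition cols_mx (n : nat) (F : 'I_n -> 'cV[C]_d) : 'M[C]_(d, n) :=
  \matrix_(j, t) F t j 0.

Lemma frame_op_cols n (F : 'I_n -> 'cV[C]_d) :
  frame_op F = cols_mx F *m (cols_mx F)^t*.
Proof.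
apply/matrixP => i j; rewrite summxE [RHS]mxE; apply: eq_bigr => t _.
by rewrite mxE big_ord1 !ctmxE !mxE.
Qed.

Lemma enorm_nsq (x : 'cV[C]_d) : enorm x ^+ 2 = \sum_j nsq (x j 0).
Proof.
have e : inner x x = (\sum_j nsq (x j 0))%:C.
  by rewrite innerE rmorph_sum; apply: eq_bigr => j _ /=; rewrite nsqE.
by rewrite /enorm e /= sqr_sqrtr // sumr_ge0 // => j _; exact: nsq_ge0.
Qed.

End Assembly.

Theorem theorem4p11 (R : realType) (d n0 k : nat)
    (F0 : 'I_n0 -> 'cV[R[i]]_d) (a : 'I_k -> R) (phi : R -> R)
    (a_noninc : forall i j : 'I_k, (i <= j)%N -> a j <= a i)
    (a_pos : forall i : 'I_k, 0 < a i)
    (phi_ge0 : forall x : R, 0 <= x -> 0 <= phi x)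
    (phi_sconvex : strictly_convex_nonneg phi)
    (G0 : 'I_k -> 'cV[R[i]]_d)
    (G0_locmin : local_minimizer (@seq_dist R d k) (in_torus a) (Psi phi F0) G0) :
  global_minimizer (in_torus a) (Psi phi F0) G0.
Proof.
case: G0_locmin => G0a [e e0 locmin]; split; first exact: G0a.
move=> G Ga.
pose S := frame_op F0.
have pS : psd S by rewrite /S frame_op_cols; exact: psd_gram.
have PsiE' (H : 'I_k -> 'cV[R[i]]_d) : Psi phi F0 H = potential phi (S + cols_mx H *m (cols_mx H)^t*).
  by rewrite -frame_op_cols.
have norms (H : 'I_k -> 'cV[R[i]]_d) t : colnsq (cols_mx H) t = enorm (H t) ^+ 2.
  by rewrite enorm_nsq; apply: eq_bigr => j _; rewrite mxE.
rewrite !PsiE'; apply: (localmin_global phi_sconvex pS).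
- exists (e ^+ 2); first by rewrite exprn_gt0.
  move=> G' nG' dG'; pose H t := col t G'.
  have eH : G' = cols_mx H by apply/matrixP => j t; rewrite !mxE.
  rewrite eH -!PsiE'; apply: locmin.
    by move=> t; rewrite -(norms H t) -eH nG' norms; exact: G0a.
  rewrite /seq_dist; apply/bigmax_ltP; split=> // t _.
  have := dG' t; rewrite eH.
  have -> : colnsq (cols_mx H - cols_mx G0) t = enorm (G0 t - H t) ^+ 2.
    rewrite enorm_nsq; apply: eq_bigr => j _; rewrite !mxE.
    by rewrite /nsq -[G0 t j 0 - _]opprB !raddfN !sqrrN.
  rewrite ltr_pXn2r ?nnegrE //; last exact: ltW.
  exact: sqrtr_ge0.
- by move=> t; rewrite norms G0a.
- by move=> t; rewrite !norms; exact: (etrans (Ga t) (esym (G0a t))).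
Qed.
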